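(* In the setting of the context, assume that the linear system $$(T_\alpha z)(t)+A(t)z(t)=Bu(t)+h(t),\quad t\in[t_1,t_2],\qquad z(\zeta)=z_0,$$ is exactly null controllable on $[\zeta,t_2]$. Then the linear operator $$H_\alpha:=(L_\zeta)^{-1}N_\zeta^{t_2}:Z\times L^{1/\xi}([\zeta,t_2];Z)\to L^2([\zeta,t_2];U)$$ is bounded, and, for $(z_0,h)\in Z\times L^{1/\xi}([\zeta,t_2];Z)$, the control $$u(t):=-H_\alpha(z_0,h)(t)=-(L_\zeta)^{-1}\Big(\Psi_\alpha(t_2,\zeta)z_0+\int_\zeta^{t_2}\Psi_\alpha(t_2,s)h(s)\,d(s,\alpha)\Big)(t)$$ steers the linear system from $z_0$ to $0$. Here $L_\zeta$ is the restriction of $L_\zeta^{t_2}$ to $[\ker L_\zeta^{t_2}]^\perp$.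
   Context: $Z,U$ are real Hilbert spaces, $\alpha\in(0,1]$, $0\le t_0<t_f$, $t_1=(\alpha t_0)^{1/\alpha}$, $t_2=(\alpha t_f)^{1/\alpha}$ (so $t^\alpha/\alpha\in[t_0,t_f]$ iff $t\in[t_1,t_2]$), $\zeta\in[t_0,t_f]\cap[t_1,t_2]$. $T_\alpha$ is the conformable derivative $(T_\alpha f)(t)=\lim_{\epsilon\to0}\frac{f(t+\epsilon t^{1-\alpha})-f(t)}{\epsilon}$; $B:U\to Z$ is bounded linear; $d(s,\alpha)=s^{\alpha-1}ds$. Assumptions on the operators $A(t)$ in $Z$, $t_0\le t^\alpha/\alpha\le t_f$: $\sigma(A(t))\subset\{\lambda\in\mathbb C:|\arg\lambda|<\omega\}$ with fixed $0<\omega<\pi/2$; (a) $A(t)$ is closed with dense domain $D(A(t))$ independent of $t$; (b) the resolvent $R_\alpha(\lambda,A(t))$ exists for $\mathrm{Re}\,\lambda\le0$ and $\|R_\alpha(\lambda,A(t))\|\le K_\alpha/(|\lambda|+1)$ for a constant $K_\alpha>0$; (c) there are $0<\delta\le1$, $K>0$ with $\|(A(t)-A(s))A^{-1}(\tau)\|\le K|t^\alpha-s^\alpha|^\delta$ for all $\frac{t^\alpha}{\alpha},\frac{s^\alpha}{\alpha},\frac{\tau^\alpha}{\alpha}\in[t_0,t_f]$; (d) $R_\alpha(\lambda,A(t))$ is compact for each $t$ and some $\lambda\in\rho(A(t))$. $\Psi_\alpha(t,s)$ is the (unique) evolution operator of $(T_\alpha x)(t)+A(t)x(t)=0$: bounded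 operators, uniformly bounded in $s\le t$, with $\Psi_\alpha(s,s)=I$, $\Psi_\alpha(t,r)\Psi_\alpha(r,s)=\Psi_\alpha(t,s)$ for $s\le r\le t$, strongly continuous, with $T_\alpha(\Psi_\alpha(\cdot,s))(t)+A(t)\Psi_\alpha(t,s)=0$ for $s<t$. $\xi$ is a constant with $0\le\xi<\min\{\alpha,\delta\}$ ($L^{1/0}=L^\infty$) and $h\in L^{1/\xi}([\zeta,t_2];Z)$. Define $L_\zeta^{t_2}:L^2([\zeta,t_2];U)\to Z$, $L_\zeta^{t_2}u=\int_\zeta^{t_2}\Psi_\alpha(t_2,s)Bu(s)\,d(s,\alpha)$, which is regarded as a bounded linear operator, and $N_\zeta^{t_2}:Z\times L^{1/\xi}([\zeta,t_2];Z)\to Z$, $N_\zeta^{t_2}(z_0,h)=\Psi_\alpha(t_2,\zeta)z_0+\int_\zeta^{t_2}\Psi_\alpha(t_2,s)h(s)\,d(s,\alpha)$. The linear system is exactly null controllable on $[\zeta,t_2]$ if $\mathrm{Im}\,L_\zeta^{t_2}\supseteq\mathrm{Im}\,N_\zeta^{t_2}$. A control $u\in L^2([\zeta,t_2];U)$ steers the system from $z_0$ to $0$ if the mild solution $z(t)=\Psi_\alpha(t,\zeta)z_0+\int_\zeta^t\Psi_\alpha(t,s)(Bu(s)+h(s))\,d(s,\alpha)$ satisfies $z(t_2)=0$, i.e. $L_\zeta^{t_2}u+N_\zeta^{t_2}(z_0,h)=0$. *)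

(* Defs.v *)
From HB Require Import structures.
From mathcomp Require Import all_boot all_order all_algebra.
From mathcomp Require Import sesquilinear complex.
From mathcomp Require Import all_classical all_reals all_analysis.

Set Implicit Arguments.
Unset Strict Implicit.
Unset Printing Implicit Defensive.
Import Order.TTheory GRing.Theory Num.Theory.
Import numFieldNormedType.Exports.

Local Open Scope classical_set_scope.
Local Open Scope ring_scope.

(* With Z : completeNormedModType R, this makes (Z, ip) a real Hilbert space. *)
Definition inner_product_norm (R : realType) (V : normedModType R)
    (ip : {dot V for idfun}) : Prop :=
  forall x : V, `|x| ^+ 2 = ip x x.

Definition bounded_operator (R : realType) (V W : normedModType R)
    (f : V -> W) : Prop :=
  exists M : R, forall x : V, `|f x| <= M * `|x|.

(* Inverse of the restriction of f to D; it is x0 outside the image f @` D. *)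
Definition inv_on (E : choiceType) (x0 : E) (F : Type) (D : set E)
    (f : E -> F) (y : F) : E :=
  xget x0 [set x | D x /\ f x = y].

Section Bochner.
Context d (T : measurableType d) (R : realType) (V : normedModType R).
Variables (mu : {measure set T -> \bar R}) (D : set T).

Definition simple_map (s : T -> V) : Prop :=
  finite_set (s @` D) /\
  forall v : V, measurable (D `&` s @^-1` [set v]) /\
    (v != 0 -> (mu (D `&` s @^-1` [set v]) < +oo)%E).

Definition simple_integral (s : T -> V) : V :=
  \sum_(v \in s @` D) fine (mu (D `&` s @^-1` [set v])) *: v.

(* Pointwise (not only a.e.) limits on D: measurable sets need not be complete
   for mu, and every a.e. class has a representative of this form. *)
Definition strongly_measurable (f : T -> V) : Prop :=
  exists s : nat -> T -> V, (forall n, simple_map (s n)) /\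
    forall x, D x -> s ^~ x @ \oo --> f x.

Definition has_bochner_integral (f : T -> V) (v : V) : Prop :=
  strongly_measurable f /\
  exists s : nat -> T -> V,
    [/\ forall n, simple_map (s n),
        (fun n => \int[mu]_(x in D) (`|f x - s n x|%:E))%E @ \oo --> 0%E &
        (fun n => simple_integral (s n)) @ \oo --> v].

Definition bochner_integrable (f : T -> V) : Prop :=
  exists v : V, has_bochner_integral f v.

Definition bochner (f : T -> V) : V := xget 0 [set v | has_bochner_integral f v].

(* Equality of elements of L^p(D; V). *)
Definition ae_equal (f g : T -> V) : Prop := {ae mu, forall x, D x -> f x = g x}.

(* The L^p norm over D of the scalar function |f|, f being extended by 0. *)
Definition Lpnorm (p : \bar R) (f : T -> V) : R :=
  fine ('N[mu]_p[EFin \o ((fun x => `|f x|)%R \_ D)])%E.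

(* Representatives of the elements of L^p(D; V). *)
Definition Lp (p : \bar R) : set (T -> V) :=
  [set f | strongly_measurable f /\ finite_norm mu p ((fun x => `|f x|) \_ D)].

Definition L2dot (ip : V -> V -> R) (f g : T -> V) : R :=
  (\int[mu]_(x in D) ip (f x) (g x))%R.

End Bochner.

Section Operators.
Context (R : realType) (Z : normedModType R).

(* The complexification of Z is Z * Z, (x, y) standing for x + iy. *)
Definition cnorm (z : Z * Z) : R := Num.sqrt (`|z.1| ^+ 2 + `|z.2| ^+ 2).

Definition cdom (DA : set Z) : set (Z * Z) := DA `*` DA.

(* lambda - A on the complexification *)
Definition lambda_minus (lambda : R[i]) (A : Z -> Z) (z : Z * Z) : Z * Z :=
  (complex.Re lambda *: z.1 - complex.Im lambda *: z.2 - A z.1,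
   complex.Im lambda *: z.1 + complex.Re lambda *: z.2 - A z.2).

Definition resolvent (lambda : R[i]) (DA : set Z) (A : Z -> Z)
    : Z * Z -> Z * Z :=
  inv_on (0 : Z * Z) (cdom DA) (lambda_minus lambda A).

Definition resolvent_set (DA : set Z) (A : Z -> Z) : set R[i] :=
  [set lambda | set_bij (cdom DA) setT (lambda_minus lambda A) /\
     exists M : R, forall z, cnorm (resolvent lambda DA A z) <= M * cnorm z].

Definition spectrum (DA : set Z) (A : Z -> Z) : set R[i] :=
  ~` resolvent_set DA A.

(* {lambda | lambda != 0, |arg lambda| < omega}, for 0 < omega <= pi *)
Definition sector (omega : R) : set R[i] :=
  [set lambda | exists r theta : R,
     [/\ 0 < r, `|theta| < omega, complex.Re lambda = r * cos theta &
         complex.Im lambda = r * sin theta]].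

Definition linear_on (DA : set Z) (A : Z -> Z) : Prop :=
  DA 0 /\ forall (a : R) x y, DA x -> DA y ->
    DA (a *: x + y) /\ A (a *: x + y) = a *: A x + A y.

Definition closed_operator (DA : set Z) (A : Z -> Z) : Prop :=
  closed [set p : Z * Z | DA p.1 /\ p.2 = A p.1].

Definition compact_operator (V W : normedModType R) (f : V -> W) : Prop :=
  forall S : set V, bounded_set S -> compact (closure (f @` S)).

Definition tau_range (alpha t0 tf t : R) : Prop :=
  0 <= t /\ t0 <= t `^ alpha / alpha <= tf.

(* A t is used only on its domain DA t. *)
Record sectorial_family (alpha t0 tf omega delta : R)
    (DA : R -> set Z) (A : R -> Z -> Z) : Prop := SectorialFamily {
  sf_linear : forall t, tau_range alpha t0 tf t -> linear_on (DA t) (A t);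
  sf_spectrum : forall t, tau_range alpha t0 tf t ->
    spectrum (DA t) (A t) `<=` sector omega;
  sf_closed : forall t, tau_range alpha t0 tf t ->
    closed_operator (DA t) (A t);
  sf_dense : forall t, tau_range alpha t0 tf t -> dense (DA t);
  sf_dom : forall t s, tau_range alpha t0 tf t -> tau_range alpha t0 tf s ->
    DA t = DA s;
  sf_resolvent : exists K : R, 0 < K /\
    forall t, tau_range alpha t0 tf t ->
    forall lambda : R[i], complex.Re lambda <= 0 ->
      resolvent_set (DA t) (A t) lambda /\
      forall z, cnorm (resolvent lambda (DA t) (A t) z)
                <= K / (ComplexField.Normc.normc lambda + 1) * cnorm z;
  sf_holder : exists K : R, 0 < K /\
    forall t s tau, tau_range alpha t0 tf t -> tau_range alpha t0 tf s ->
      tau_range alpha t0 tf tau ->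
    forall z : Z, let x := inv_on 0 (DA tau) (A tau) z in
      `|A t x - A s x| <= K * `|t `^ alpha - s `^ alpha| `^ delta * `|z|;
  sf_compact : forall t, tau_range alpha t0 tf t ->
    exists2 lambda, resolvent_set (DA t) (A t) lambda &
      compact_operator (resolvent lambda (DA t) (A t))
}.

(* (T_alpha f)(t) = l, for f defined on J: the limit is over the epsilon <> 0
   with t + epsilon t^(1 - alpha) in J, hence two-sided for t interior to J. *)
Definition is_conformable_derivative (alpha : R) (J : set R) (f : R -> Z)
    (t : R) (l : Z) : Prop :=
  (fun e : R => e^-1 *: (f (t + e * t `^ (1 - alpha)) - f t))
    @ within [set e | J (t + e * t `^ (1 - alpha))] 0^' --> l.

Record evolution_operator (alpha t1 t2 : R) (DA : R -> set Z)
    (A : R -> Z -> Z) (Psi : R -> R -> Z -> Z) : Prop := EvolutionOperator {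
  ev_linear : forall s t, t1 <= s -> s <= t -> t <= t2 -> linear (Psi t s);
  ev_bounded : exists M : R, forall s t, t1 <= s -> s <= t -> t <= t2 ->
    forall z, `|Psi t s z| <= M * `|z|;
  ev_id : forall s, t1 <= s -> s <= t2 -> forall z, Psi s s z = z;
  ev_comp : forall s r t, t1 <= s -> s <= r -> r <= t -> t <= t2 ->
    forall z, Psi t r (Psi r s z) = Psi t s z;
  ev_continuous : forall z,
    {within [set p : R * R | [/\ t1 <= p.2, p.2 <= p.1 & p.1 <= t2]],
      continuous (fun p => Psi p.1 p.2 z)};
  ev_derivative : forall s t, t1 <= s -> s < t -> t <= t2 ->
    forall z, DA t (Psi t s z) /\
      is_conformable_derivative alpha `[s, t2] (fun r => Psi r s z) t
        (- A t (Psi t s z))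
}.

End Operators.

Section Control.
Context (R : realType) (Z U : normedModType R).
Variables (alpha zeta t2 : R) (Psi : R -> R -> Z -> Z) (B : U -> Z).

Local Notation mu := (@lebesgue_measure R).
Local Notation I := (`[zeta, t2]%classic).

(* s |-> s^(alpha-1) Psi(t, s) g(s): its integral with respect to ds is the
   integral of Psi(t, s) g(s) with respect to d(s, alpha). *)
Definition weighted (t : R) (g : R -> Z) (s : R) : Z :=
  s `^ (alpha - 1) *: Psi t s (g s).

Definition Lop (u : R -> U) : Z :=
  bochner mu I (weighted t2 (fun s => B (u s))).

Definition Nop (z0 : Z) (h : R -> Z) : Z :=
  Psi t2 zeta z0 + bochner mu I (weighted t2 h).

Definition Lop_bounded : Prop :=
  (forall u, Lp mu I 2%:E u ->
     bochner_integrable mu I (weighted t2 (fun s => B (u s)))) /\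
  exists C : R, forall u, Lp mu I 2%:E u ->
    `|Lop u| <= C * Lpnorm mu I 2%:E u.

Definition exactly_null_controllable (p : \bar R) : Prop :=
  [set Nop q.1 q.2 | q in setT `*` Lp mu I p] `<=` Lop @` Lp mu I 2%:E.

Definition Lker : set (R -> U) := [set u | Lp mu I 2%:E u /\ Lop u = 0].

Definition Lker_perp (ipU : U -> U -> R) : set (R -> U) :=
  [set u | Lp mu I 2%:E u /\ forall v, Lker v -> L2dot mu I ipU u v = 0].

Definition Hop (ipU : U -> U -> R) (z0 : Z) (h : R -> Z) : R -> U :=
  inv_on (0 : R -> U) (Lker_perp ipU) Lop (Nop z0 h).

Definition mild_solution (z0 : Z) (u : R -> U) (h : R -> Z) (t : R) : Z :=
  Psi t zeta z0 +
  bochner mu `[zeta, t]%classic (weighted t (fun s => B (u s) + h s)).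

Definition steers_to_0 (z0 : Z) (u : R -> U) (h : R -> Z) : Prop :=
  bochner_integrable mu I (weighted t2 (fun s => B (u s) + h s)) /\
  mild_solution z0 u h t2 = 0.

End Control.

(* Main.v *)
Require Import Defs.
From HB Require Import structures.
From mathcomp Require Import all_boot all_order all_algebra.
From mathcomp Require Import sesquilinear complex.
From mathcomp Require Import all_classical all_reals all_analysis.
From mathcomp Require Import measurable_realfun ess_sup_inf ring lra.

Set Implicit Arguments.
Unset Strict Implicit.
Unset Printing Implicit Defensive.
Import Order.TTheory GRing.Theory Num.Theory.
Import numFieldNormedType.Exports.

Local Open Scope classical_set_scope.
Local Open Scope ring_scope.

(** The controls form a complete space L^2, and L is linear and bounded on it.
    Null controllability says that every [N (z0, h)] is attained by L; among the
    controls attaining it there is one of least norm, by the parallelogram law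
    and completeness, and having least norm amounts to being orthogonal to the
    kernel of L ([perp_exists], [perp_unique]).  This is the control [H (z0, h)];
    it is unique, hence linear in [(z0, h)], up to equality almost everywhere.
    Steering is then the additivity of the integral:
    [- L (H (z0, h)) + N (z0, h) = 0].

    Boundedness of H is a closed graph argument.  The function
    [x |-> |H x|] is a finite seminorm on the complete space Z x L^(1/xi), and it
    is lower semicontinuous: if [x_n] tends to [x] and [|H x_n| <= c], the controls
    of norm at most [c] that L sends close to [N x] form decreasing convex sets,
    whose points of almost least norm converge to a control of norm at most [c]
    attaining [N x] ([least_norm_limit], [perp_norm_le]).  A lower semicontinuous
    finite seminorm on a complete space is bounded ([lsc_seminorm_bounded], by
    nested balls).  The continuity of N used here is Hoelder's inequality: the
    weight [s^(alpha - 1)] has a finite norm for the exponent conjugate to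
    [1 / xi] since [xi < alpha] ([weight_Lq], [Nop_bounded]).

    The analytic input is the theory of strongly measurable functions on a set of
    finite measure: a function of integrable norm is Bochner integrable
    ([bochner_integrable_of_norm]), and L^p is complete ([Lp_complete]).  Both
    rest on the L^1 approximation by simple maps ([L1_approximation]). *)

(** * Complete seminormed spaces *)

Section SeminormedSpace.
Context (R : realType) (E : lmodType R) (P : set E) (nu : E -> R).

(** [P] is a subspace and [nu] a seminorm on it; nothing is asked of [nu] outside
    of [P].  Definiteness is not required: spaces of functions are not quotiented
    by equality almost everywhere. *)
Record seminorm_on : Prop := SeminormOn {
  sn_0 : P 0;
  sn_linear : forall (a : R) x y, P x -> P y -> P (a *: x + y);
  sn_ge0 : forall x, P x -> 0 <= nu x;
  sn_Z : forall (a : R) x, P x -> nu (a *: x) = `|a| * nu x;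
  sn_D : forall x y, P x -> P y -> nu (x + y) <= nu x + nu y
}.

(** Completeness, tested on sequences whose increments decay geometrically; the
    rate is the one obtained by summing the increments. *)
Definition rapidly_complete : Prop :=
  forall u : nat -> E, (forall n, P (u n)) ->
    (forall n, nu (u n.+1 - u n) <= 2^-1 ^+ n) ->
    exists v, P v /\ forall n, nu (v - u n) <= 2 * 2^-1 ^+ n.

Hypothesis snu : seminorm_on.

Lemma subspaceD x y : P x -> P y -> P (x + y).
Proof. by move=> Px Py; rewrite -[x]scale1r; exact: sn_linear. Qed.

Lemma subspaceZ (a : R) x : P x -> P (a *: x).
Proof. by move=> Px; rewrite -[_ *: _]addr0; apply: sn_linear => //; exact: sn_0. Qed.

Lemma subspaceN x : P x -> P (- x).
Proof. by move=> Px; rewrite -scaleN1r; exact: subspaceZ. Qed.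

Lemma subspaceB x y : P x -> P y -> P (x - y).
Proof. by move=> Px Py; apply: subspaceD => //; exact: subspaceN. Qed.

Lemma sn_N x : P x -> nu (- x) = nu x.
Proof. by move=> Px; rewrite -scaleN1r sn_Z// normrN1 mul1r. Qed.

Lemma sn_subC x y : P x -> P y -> nu (x - y) = nu (y - x).
Proof. by move=> Px Py; rewrite -opprB sn_N//; exact: subspaceB. Qed.

Lemma sn_triangle z x y : P x -> P y -> P z -> nu (x - y) <= nu (x - z) + nu (z - y).
Proof.
move=> Px Py Pz; rewrite -[x - y](_ : (x - z) + (z - y) = _); last by rewrite subrKA.
by apply: (sn_D snu); exact: subspaceB.
Qed.

Lemma exp_half_small (e : R) : 0 < e -> exists n, 2^-1 ^+ n < e.
Proof.
move=> e0; have h : `|2^-1 : R| < 1 by rewrite ger0_norm// invf_lt1// ltr1n.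
have /cvgr0Pnorm_lt/(_ _ e0)[N _ /(_ N (leqnn _))] := cvg_expr h.
by rewrite ger0_norm ?exprn_ge0//; exists N.
Qed.

Lemma le_of_exp_half (a b k : R) : (forall n, a <= b + k * 2^-1 ^+ n) -> a <= b.
Proof.
move=> ab; apply/ler_addgt0Pr => e e0.
have k0 : 0 < `|k| + 1 by rewrite ltr_wpDl.
have [n hn] := exp_half_small (divr_gt0 e0 k0).
apply: le_trans (ab n) _; rewrite lerD2l.
rewrite ltr_pdivlMr// in hn; apply: le_trans (ltW hn); rewrite mulrC.
by rewrite ler_wpM2l ?exprn_ge0// ler_wpDr// ler_norm.
Qed.

Lemma rapid_dist (u : nat -> E) :
  (forall n, P (u n)) -> (forall n, nu (u n.+1 - u n) <= 2^-1 ^+ n) ->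
  forall n k, nu (u (n + k)%N - u n) <= 2 * 2^-1 ^+ n.
Proof.
move=> Pu uc n k.
suff : nu (u (n + k)%N - u n) <= 2 * (2^-1 ^+ n - 2^-1 ^+ (n + k)).
  by move/le_trans; apply; rewrite ler_wpM2l// gerBl exprn_ge0.
elim: k => [|k IH].
  rewrite addn0 !subrr mulr0 -(scale0r 0) sn_Z ?normr0 ?mul0r//; exact: sn_0.
rewrite addnS; apply: le_trans (sn_triangle (Pu _) (Pu _) (Pu (n + k)%N)) _.
by apply: le_trans (lerD (uc _) IH) _; rewrite exprS; lra.
Qed.

(** A geometric rate of convergence of a sequence with geometrically small
    increments always holds with the constant 2. *)
Lemma rapid_limit (u : nat -> E) (v : E) (k : R) : P v ->
  (forall n, P (u n)) -> (forall n, nu (u n.+1 - u n) <= 2^-1 ^+ n) ->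
  (forall n, nu (v - u n) <= k * 2^-1 ^+ n) ->
  forall n, nu (v - u n) <= 2 * 2^-1 ^+ n.
Proof.
move=> Pv Pu uc vu n; apply: (@le_of_exp_half _ _ `|k|) => m.
apply: le_trans (sn_triangle Pv (Pu n) (Pu (n + m)%N)) _.
rewrite addrC; apply: lerD; first exact: rapid_dist.
apply: le_trans (vu _) _; apply: (@le_trans _ _ (`|k| * 2^-1 ^+ (n + m))).
  by rewrite ler_wpM2r ?exprn_ge0// ler_norm.
by rewrite ler_wpM2l// exprD ler_piMl ?exprn_ge0// exprn_ile1// invf_le1// ler1n.
Qed.

(** Uniform boundedness: on a complete space a lower semicontinuous finite
    seminorm [q] is bounded.  Otherwise [q] takes arbitrarily large values near
    every point, so that there are nested balls on which lower bounds of [q] tend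
    to infinity, and [q] would be infinite at their common point. *)
Theorem lsc_seminorm_bounded (q : E -> R) :
  rapidly_complete ->
  (forall x, P x -> 0 <= q x) ->
  (forall (a : R) x, P x -> q (a *: x) = `|a| * q x) ->
  (forall x y, P x -> P y -> q (x + y) <= q x + q y) ->
  (forall x c, P x -> c < q x -> exists2 r, 0 < r &
     forall y, P y -> nu (y - x) <= r -> c < q y) ->
  exists C : R, forall x, P x -> q x <= C * nu x.
Proof.
move=> cplt q0 qZ qD qlsc; apply: contrapT => nobound.
have big C : exists2 x, P x & C * nu x < q x.
  apply: contrapT => h; apply: nobound; exists C => x Px.
  by rewrite leNgt; apply/negP => qx; apply: h; exists x.
(* an unbounded seminorm is unbounded on every ball *)
have large x r K : P x -> 0 < r -> exists y, [/\ P y, nu (y - x) <= r & K < q y].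
  move=> Px r0; pose M : R := `|K| + q x + 1.
  have M0 : 0 < M by rewrite /M ltr_wpDl// addr_ge0// q0.
  suff [z [Pz nz qz]] : exists z, [/\ P z, nu z <= r & M <= q z].
    exists (x + z); split; [exact: subspaceD|by rewrite addrC addKr|].
      have : q z <= q (x + z) + q x.
        rewrite -{1}[z](addKr x) addrC -[q x]mul1r -normrN1 -qZ// scaleN1r.
        by apply: qD; [exact: subspaceD|exact: subspaceN].
      have := ler_norm K; rewrite /M in qz; lra.
  have [z Pz qz] := big (M / r).
  have [nz0|nz0] := eqVneq (nu z) 0.
    rewrite nz0 mulr0 in qz; exists ((M / q z) *: z); split; first exact: subspaceZ.
      by rewrite sn_Z// nz0 mulr0 ltW.
    rewrite qZ// ger0_norm; last by rewrite divr_ge0// ltW.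
    by rewrite divfK// gt_eqF.
  have nz : 0 < nu z by rewrite lt0r nz0 sn_ge0.
  exists ((r / nu z) *: z); split; first exact: subspaceZ.
    by rewrite sn_Z// ger0_norm ?divfK// divr_ge0// ltW.
  rewrite qZ// ger0_norm; last by rewrite divr_ge0// ltW.
  have -> : M = r / nu z * (M / r * nu z).
    by field; rewrite nz0 gt_eqF.
  by rewrite ler_wpM2l ?ltW// divr_gt0.
(* states are triples (center, radius, lower bound of q on the ball) *)
pose good (t : E * R * R) := [/\ P t.1.1, 0 < t.1.2 &
  forall y, P y -> nu (y - t.1.1) <= t.1.2 -> t.2 < q y].
have /choice[F FP] (t : E * R * R) : exists t', good t ->
    [/\ good t', nu (t'.1.1 - t.1.1) <= t.1.2 / 4, t'.1.2 <= t.1.2 / 4 &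
        t'.2 = t.2 + 1].
  have [gt|ngt] := pselect (good t); last by exists t.
  have [Pt r0 _] := gt; have r4 : 0 < t.1.2 / 4 by rewrite divr_gt0.
  have [y [Py yt qy]] := large _ _ (t.2 + 1) Pt r4.
  have [r r1 qr] := qlsc _ _ Py qy.
  exists (y, Num.min r (t.1.2 / 4), t.2 + 1) => _; split => //=.
    split => //=; first by rewrite lt_min r1.
    by move=> z Pz; rewrite le_min => /andP[zr _]; exact: qr.
  by rewrite ge_min lexx orbT.
pose s n := iter n F (0, 1, -1).
have gs n : good (s n).
  elim: n => [|n IH]; last by have [] := FP _ IH.
  split => //=; first exact: sn_0.
  by move=> y Py _; apply: lt_le_trans (q0 _ Py); rewrite ltrN10.
have sP n : P (s n).1.1 by case: (gs n).
have dist n : nu ((s n.+1).1.1 - (s n).1.1) <= (s n).1.2 / 4.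
  by have [] := FP _ (gs n).
have rad n : (s n.+1).1.2 <= (s n).1.2 / 4 by have [] := FP _ (gs n).
have rad0 n : 0 < (s n).1.2 by case: (gs n).
have radn n : (s n).1.2 <= 2^-1 ^+ n.
  elim: n => [|n IH]; first by rewrite expr0.
  have h : (0 : R) <= 2^-1 ^+ n by rewrite exprn_ge0.
  by apply: le_trans (rad n) _; rewrite exprS; lra.
have [v [Pv vs]] : exists v, P v /\ forall n, nu (v - (s n).1.1) <= 2 * 2^-1 ^+ n.
  apply: cplt => // n; apply: le_trans (dist n) _.
  by have := radn n; have := rad0 n; lra.
have bound n : (s n).2 = n%:R - 1.
  elim: n => [|n IH]; first by rewrite sub0r.
  have [_ _ _ ->] := FP _ (gs n); rewrite -/(s n) IH -natr1; lra.
have tail n k : nu ((s (n + k)%N).1.1 - (s n).1.1) <=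
    ((s n).1.2 - (s (n + k)%N).1.2) / 2.
  elim: k => [|k IH].
    by rewrite addn0 !subrr mul0r -(scale0r 0) sn_Z ?normr0 ?mul0r//; exact: sn_0.
  rewrite addnS; apply: le_trans (sn_triangle (sP _) (sP _) (sP (n + k)%N)) _.
  have := dist (n + k)%N; have := rad (n + k)%N; have := rad0 (n + k)%N.
  by move: IH; lra.
have qv n : n%:R - 1 < q v.
  rewrite -bound; have [_ _] := gs n; apply=> //.
  apply: (@le_of_exp_half _ _ 2) => k.
  apply: le_trans (sn_triangle Pv (sP n) (sP (n + k)%N)) _.
  have := tail n k; have := vs (n + k)%N; have := rad0 n; have := rad0 (n + k)%N.
  have : (2^-1 : R) ^+ (n + k) <= 2^-1 ^+ k.
    by rewrite exprD ler_piMl ?exprn_ge0// exprn_ile1// invf_le1// ler1n.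
  by lra.
have := qv (Num.truncn (q v)).+2.
by have := truncnS_gt (q v); rewrite -[_.+2%:R]natr1; lra.
Qed.

(** If decreasing midpoint-convex sets all meet a fixed ball, points [u n] of
    almost least norm in them form a Cauchy sequence by the parallelogram law; the
    norm of their limit [v] is at most [c] as soon as all the sets meet the ball of
    radius [c].  A constant sequence of sets gives an orthogonal projection; the
    general case replaces the weak compactness of balls. *)
Theorem least_norm_limit (C : nat -> set E) (c0 : R) :
  rapidly_complete ->
  (forall x y, P x -> P y ->
     nu (x + y) ^+ 2 + nu (x - y) ^+ 2 = 2 * (nu x ^+ 2 + nu y ^+ 2)) ->
  (forall m n, (m <= n)%N -> C n `<=` C m) ->
  (forall n, C n `<=` P) ->
  (forall n x y, C n x -> C n y -> C n (2^-1 *: (x + y))) ->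
  (forall n, exists2 x, C n x & nu x <= c0) ->
  exists v u, [/\ P v, forall n, C n (u n),
    forall n, nu (v - u n) <= 2 * 2^-1 ^+ n &
    forall c, (forall n, exists2 x, C n x & nu x <= c) -> nu v <= c].
Proof.
move=> cplt para Cdec CP Cmid Cc0.
pose K n := [set nu x ^+ 2 | x in C n].
have K0 n : has_inf (K n).
  split; first by have [x Cx _] := Cc0 n; exists (nu x ^+ 2), x.
  by exists 0 => _ [x _ <-]; rewrite sqr_ge0.
pose I n := inf (K n).
have I_le n x : C n x -> I n <= nu x ^+ 2.
  by move=> Cx; apply: ge_inf; [case: (K0 n)|exists x].
have I_mono m n : (m <= n)%N -> I m <= I n.
  move=> mn; apply: lb_le_inf; first by case: (K0 n).
  by move=> _ [x Cx <-]; apply: I_le; exact: Cdec Cx.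
have I_bound c n : (exists2 x, C n x & nu x <= c) -> I n <= c ^+ 2.
  move=> [x Cx xc]; apply: le_trans (I_le n x Cx) _.
  by rewrite ler_sqr ?nnegrE ?(le_trans _ xc)// sn_ge0//; exact: CP Cx.
have supI : has_sup (range I).
  split; first by exists (I 0%N), 0%N.
  by exists (c0 ^+ 2) => _ [n _ <-]; exact: I_bound.
pose d := sup (range I).
have I_d n : I n <= d by apply: ub_le_sup; [case: supI|exists n].
(* tolerances for which u n and u n.+1 are at distance at most 2^-n *)
pose e n : R := (2^-1 ^+ n) ^+ 2 / 8.
have e0 n : 0 < e n by rewrite /e divr_gt0// exprn_gt0// exprn_gt0.
have /choice[u uP] n : exists u, exists m, [/\ (n <= m)%N, d - e n < I m,
    C m u & nu u ^+ 2 < d + e n].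
  have [_ [m _ <-] dm] := sup_adherent (e0 n) supI.
  have [_ [x Cx <-] xe] := inf_adherent (e0 n) (K0 (n + m)%N).
  exists x, (n + m)%N; split => //; first exact: leq_addr.
    by apply: lt_le_trans dm _; apply: I_mono; exact: leq_addl.
  by apply: lt_le_trans xe _; rewrite lerD2r; exact: I_d.
have uC n : C n (u n) by have [m [nm _ Cm _]] := uP n; exact: Cdec Cm.
have uPP n : P (u n) by exact: CP (uC n).
have e_mono n : e n.+1 <= e n.
  rewrite /e ler_wpM2r// ler_sqr ?nnegrE ?exprn_ge0// exprS.
  by rewrite ler_piMl ?exprn_ge0// invf_le1// ler1n.
have close n : nu (u n.+1 - u n) <= 2^-1 ^+ n.
  have [m [_ dm Cm um]] := uP n; have [m' [_ dm' Cm' um']] := uP n.+1.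
  have [k dk [Ck Ck']] : exists2 k, d - e n < I k & C k (u n) /\ C k (u n.+1).
    have [mm'|/ltnW m'm] := leqP m m'.
      by exists m => //; split => //; exact: Cdec Cm'.
    exists m'; last by split => //; exact: Cdec Cm.
    by apply: le_lt_trans dm'; rewrite lerB.
  have := I_le _ _ (Cmid _ _ _ Ck' Ck).
  rewrite (sn_Z snu); last exact: subspaceD.
  rewrite ger0_norm// exprMn => mid.
  have := para _ _ (uPP n.+1) (uPP n); have := e_mono n => en pl.
  rewrite -ler_sqr ?nnegrE ?exprn_ge0 ?(sn_ge0 snu)//; last exact: subspaceB.
  have -> : (2^-1 ^+ n) ^+ 2 = 8 * e n by rewrite /e mulrC divfK.
  move: mid pl um um' dk en.
  set a := nu (_ + _) ^+ 2; set b := nu (_ - _) ^+ 2.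
  by rewrite (_ : 2^-1 ^+ 2 = 4^-1); [lra|rewrite exprVn -natrX].
have [v [Pv vu]] := cplt u uPP close.
exists v, u; split => // c Cc.
have c_ge0 : 0 <= c.
  by have [x Cx] := Cc 0%N; apply: le_trans; apply: (sn_ge0 snu); exact: CP Cx.
have dc : d <= c ^+ 2.
  apply: ge_sup; first by case: supI.
  by move=> _ [n _ <-]; exact: I_bound.
apply: (@le_of_exp_half _ _ 3) => n.
rewrite -[v](subrK (u n)); apply: le_trans (sn_D snu (subspaceB Pv (uPP n)) (uPP n)) _.
have : nu (u n) <= c + 2^-1 ^+ n.
  have h0 : (0 : R) <= 2^-1 ^+ n by rewrite exprn_ge0.
  rewrite -ler_sqr ?nnegrE ?addr_ge0 ?(sn_ge0 snu)//.
  have [m [_ _ _ /ltW um]] := uP n; apply: le_trans um _.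
  rewrite /e sqrrD; have := mulr_ge0 c_ge0 h0.
  by have := sqr_ge0 ((2^-1 : R) ^+ n); rewrite mulr2n; lra.
by have := vu n; lra.
Qed.

End SeminormedSpace.

Lemma complete_normed_rapidly (R : realType) (V : completeNormedModType R) :
  seminorm_on setT (fun v : V => `|v|) /\
  rapidly_complete setT (fun v : V => `|v|).
Proof.
have sV : seminorm_on setT (fun v : V => `|v|).
  by split => // [a x _|x y _ _]; [exact: normrZ|exact: ler_normD].
split => // u _ uc.
have : cvgn (series (telescope u)).
  apply: normed_cvg; apply: (@series_le_cvg _ _ (geometric 1 2^-1)) => //.
  - by move=> n; exact: normr_ge0.
  - by move=> n; rewrite /geometric/= mul1r exprn_ge0.
  - by move=> n; rewrite /geometric/= mul1r; exact: uc.
  - by apply: is_cvg_geometric_series; rewrite ger0_norm// invf_lt1// ltr1n.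
rewrite telescopeK => /cvg_ex[l ul].
have uv : u @ \oo --> l + u 0%N.
  have : (fun n => (u n - u 0%N) + u 0%N) @ \oo --> l + u 0%N.
    by apply: cvgD; [exact: ul|exact: cvg_cst].
  by under eq_fun do rewrite subrK.
exists (l + u 0%N); split => // n.
apply: (@cvgr_to_le _ \oo _ _ (fun k => `|u (n + k)%N - u n|)); last first.
  by apply: nearW => k; exact: (rapid_dist sV).
apply: cvg_norm; apply: cvgB; last exact: cvg_cst.
have := uv; rewrite -(cvg_shiftn n); apply: cvg_trans.
by under eq_fun do rewrite addnC.
Qed.

Section ProductSeminorm.
Context (R : realType) (E F : lmodType R) (P : set E) (Q : set F).
Variables (nuE : E -> R) (nuF : F -> R).
Hypotheses (sE : seminorm_on P nuE) (sF : seminorm_on Q nuF).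

Lemma prod_seminorm :
  seminorm_on (P `*` Q) (fun x : E * F => nuE x.1 + nuF x.2).
Proof.
split.
- by split; [exact: (sn_0 sE)|exact: (sn_0 sF)].
- move=> a x y [Px Qx] [Py Qy].
  by split; [exact: (sn_linear sE)|exact: (sn_linear sF)].
- by move=> x [Px Qx]; rewrite addr_ge0//; [exact: (sn_ge0 sE)|exact: (sn_ge0 sF)].
- by move=> a x [Px Qx]; rewrite (sn_Z sE)// (sn_Z sF)// mulrDr.
- move=> x y [Px Qx] [Py Qy]; rewrite addrACA.
  by apply: lerD; [exact: (sn_D sE)|exact: (sn_D sF)].
Qed.

Lemma prod_rapidly_complete : rapidly_complete P nuE -> rapidly_complete Q nuF ->
  rapidly_complete (P `*` Q) (fun x : E * F => nuE x.1 + nuF x.2).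
Proof.
move=> cE cF u PQu uc.
have Pu n : P (u n).1 by case: (PQu n).
have Qu n : Q (u n).2 by case: (PQu n).
have Pdu n : 0 <= nuE ((u n.+1).1 - (u n).1) by apply: (sn_ge0 sE); exact: (subspaceB sE).
have Qdu n : 0 <= nuF ((u n.+1).2 - (u n).2) by apply: (sn_ge0 sF); exact: (subspaceB sF).
have [|v [Pv vu]] := cE (fun n => (u n).1) Pu.
  by move=> n; apply: le_trans (uc n); rewrite /= lerDl.
have [|w [Qw wu]] := cF (fun n => (u n).2) Qu.
  by move=> n; apply: le_trans (uc n); rewrite /= lerDr.
exists (v, w); split => //.
apply: (rapid_limit prod_seminorm (k := 4)) => // n.
by have := vu n; have := wu n; rewrite /=; lra.
Qed.

End ProductSeminorm.

(** * Finite-valued maps and their integrals *)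

Section FiniteValuedMaps.
Context d (T : measurableType d) (R : realType).
Variables (mu : {measure set T -> \bar R}) (D : set T).
Hypotheses (mD : measurable D) (muD : (mu D < +oo)%E).

(** [step r]: on [D] the map [r] takes finitely many values, each on a
    measurable set.  The codomain is an arbitrary type, so that several maps can
    be bundled into a single tuple-valued one. *)
Definition step (W : Type) (r : T -> W) : Prop :=
  finite_set (r @` D) /\ forall w, measurable (D `&` r @^-1` [set w]).

Lemma step_measurable (W : Type) (r : T -> W) (Y : set W) :
  step r -> measurable (D `&` r @^-1` Y).
Proof.
move=> [fr mr].
have -> : D `&` r @^-1` Y =
    \bigcup_(w in (r @` D) `&` Y) (D `&` r @^-1` [set w]).
  apply/seteqP; split => [x [Dx Yx]|x [w [_ Yw] [Dx /= rx]]].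
    by exists (r x) => //; split => //; exists x.
  by split => //=; rewrite rx.
by apply: fin_bigcup_measurable => //; exact: finite_setIl.
Qed.

Lemma step_comp (W W' : Type) (F : W -> W') (r : T -> W) :
  step r -> step (F \o r).
Proof.
move=> sr; split; first by rewrite -image_comp; apply: finite_image; case: sr.
move=> w; rewrite comp_preimage; exact: step_measurable.
Qed.

Lemma step_pair (W W' : Type) (r : T -> W) (r' : T -> W') :
  step r -> step r' -> step (fun x => (r x, r' x)).
Proof.
move=> [fr mr] [fr' mr']; split.
  apply: (sub_finite_set _ (finite_setX fr fr')).
  by move=> _ [x Dx <-]; split; exists x.
move=> [w w'].
have -> : D `&` (fun x => (r x, r' x)) @^-1` [set (w, w')] =
    (D `&` r @^-1` [set w]) `&` (D `&` r' @^-1` [set w']).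
  apply/seteqP; split => [x [Dx [<- <-]]//|x [[Dx /= <-] [_ /= <-]]//].
exact: measurableI.
Qed.

Lemma measurable_step_bool (b : T -> bool) :
  measurable (D `&` [set x | b x]) -> step b.
Proof.
move=> mb; split; first exact: finite_finset.
case; first exact: mb.
have -> : D `&` b @^-1` [set false] = D `\` (D `&` [set x | b x]).
  apply/seteqP; split => [x [Dx /= bx]|x [Dx /= nb]].
    by split => // -[_] /=; rewrite bx.
  by split => //=; apply/negbTE/negP => bx; apply: nb.
exact: measurableD.
Qed.

Lemma step_measurable_fun d' (T' : measurableType d') (r : T -> T') :
  step r -> measurable_fun D r.
Proof. by move=> sr _ Y _; exact: step_measurable. Qed.

Lemma simple_mapP (V : normedModType R) (s : T -> V) :
  simple_map mu D s <-> step s.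
Proof.
split=> [[fs ms]|[fs ms]]; split => // v; first by case: (ms v).
split; first exact: ms.
move=> _; apply: le_lt_trans muD; apply: le_measure; rewrite ?inE//.
Qed.

Local Notation weight r w := (mu (D `&` r @^-1` [set w])).

Lemma weight_fin_num (W : Type) (r : T -> W) w :
  step r -> weight r w \is a fin_num.
Proof.
move=> [_ mr]; rewrite ge0_fin_numE ?measure_ge0//.
by apply: le_lt_trans muD; apply: le_measure; rewrite ?inE.
Qed.

Lemma weight_comp (W W' : choiceType) (F : W -> W') (r : T -> W) w' :
  step r -> weight (F \o r) w' =
    (\sum_(w \in r @` D) if F w == w' then weight r w else 0)%E.
Proof.
move=> sr; have [fr mr] := sr.
transitivity (\sum_(w \in (r @` D) `&` F @^-1` [set w']) weight r w)%E.
  rewrite -content_fin_bigcup//.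
  - congr (mu _); apply/seteqP; split => [x [Dx /= Fx]|x [w [_ /= Fw]] [Dx /= rx]].
      by exists (r x) => //; split => //; exists x.
    by split => //=; rewrite rx.
  - exact: finite_setIl.
  - apply/trivIsetP => i j _ _ /eqP ij; apply/seteqP; split => // x [[_ /= xi] [_ /= xj]].
    by apply: ij; rewrite -xi -xj.
  - by apply: fin_bigcup_measurable => //; exact: finite_setIl.
rewrite [RHS](fsbigID (F @^-1` [set w']))//= [X in (_ + X)%E]fsbig1 ?adde0//.
  by apply: eq_fsbigr => w; rewrite inE => -[_ /= ->]; rewrite eqxx.
by move=> w [_ /= /eqP/negbTE ->].
Qed.

Lemma simple_integral_comp (W : choiceType) (V : normedModType R) (F : W -> V)
    (r : T -> W) : step r ->
  simple_integral mu D (F \o r) =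
    \sum_(w \in r @` D) fine (weight r w) *: F w.
Proof.
move=> sr; have [fr mr] := sr.
have fFr : finite_set ((F \o r) @` D) by have [] := step_comp F sr.
transitivity (\sum_(v \in (F \o r) @` D) \sum_(w \in r @` D)
    (if F w == v then fine (weight r w) *: F w else 0)).
  apply: eq_fsbigr => v _; rewrite weight_comp//.
  rewrite (@fsbig_finite _ _ _ _ _ _ fr)/= -sum_fine; last first.
    by move=> w _; case: ifP => // _; exact: weight_fin_num.
  rewrite scaler_suml fsbig_finite//=; apply: eq_bigr => w _.
  by case: eqP => [->//|]; rewrite scale0r.
rewrite exchange_fsbig//; apply: eq_fsbigr => w; rewrite inE => -[x Dx <-].
rewrite (fsbigD1 (F (r x)))//=; last by exists x.
  rewrite eqxx fsbig1 ?addr0// => v [_ /= nv].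
  by case: eqP => // Fv; case: nv.
Qed.

Lemma integral_step (W : choiceType) (phi : W -> R) (r : T -> W) :
  step r -> (forall w, 0 <= phi w) ->
  (\int[mu]_(x in D) (phi (r x))%:E)%E =
    (\sum_(w \in r @` D) fine (weight r w) * phi w)%:E.
Proof.
move=> sr phi0; have [fr mr] := sr.
transitivity (\int[mu]_(x in D) \sum_(w \in r @` D)
    ((phi w)%:E * (\1_(D `&` r @^-1` [set w]) x)%:E))%E.
  apply: eq_integral => x; rewrite inE => Dx.
  rewrite (fsbigD1 (r x))//=; last by exists x.
  rewrite indicE mem_set//= mule1 fsbig1 ?adde0// => w [_ /= nw].
  by rewrite indicE memNset ?mule0//= => -[_ /= rw]; apply: nw.
rewrite ge0_integral_fsum//.
- rewrite !fsbig_finite//= -sumEFin.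
  apply: eq_bigr => w _.
  rewrite ge0_integralZl//; last by rewrite lee_fin.
    rewrite integral_indic//= setIAC setIid EFinM fineK ?weight_fin_num//.
    by rewrite muleC setIC.
  exact/measurable_EFinP/measurable_indic.
- move=> w; apply: measurable_funeM.
  exact/measurable_EFinP/measurable_indic.
- by move=> w x _; rewrite mule_ge0 ?lee_fin.
Qed.

Lemma simple_integral_norm (V : normedModType R) (s : T -> V) : step s ->
  (`|simple_integral mu D s|%:E <= \int[mu]_(x in D) `|s x|%:E)%E.
Proof.
move=> ss; have [fs _] := ss.
rewrite (integral_step (phi := fun v => `|v|))// lee_fin.
rewrite -[X in simple_integral _ _ X]/(idfun \o s) simple_integral_comp//.
rewrite !fsbig_finite//=; apply: le_trans (ler_norm_sum _ _ _) _.
apply: ler_sum => v _; rewrite normrZ ger0_norm// fine_ge0//.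
Qed.

Lemma simple_integral_linear (V : normedModType R) (a : R) (s t : T -> V) :
  step s -> step t ->
  simple_integral mu D (fun x => a *: s x + t x) =
    a *: simple_integral mu D s + simple_integral mu D t.
Proof.
move=> ss st; have sst := step_pair ss st; have [f _] := sst.
rewrite -[LHS]/(simple_integral mu D
  ((fun w : V * V => a *: w.1 + w.2) \o (fun x => (s x, t x)))).
rewrite -[X in a *: X]/(simple_integral mu D (fst \o (fun x => (s x, t x)))).
rewrite -[X in _ + X]/(simple_integral mu D (snd \o (fun x => (s x, t x)))).
rewrite !simple_integral_comp// !fsbig_finite//= scaler_sumr -big_split/=.
by apply: eq_bigr => w _; rewrite scalerDr scalerA mulrC -scalerA.
Qed.

End FiniteValuedMaps.

(** * Strong measurability and the Bochner integral *)

Section ErealLimits.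
Context (R : realType).

Lemma cvge0_lt (b : nat -> \bar R) : b @ \oo --> 0%E ->
  forall e, 0 < e -> \forall n \near \oo, (b n < e%:E)%E.
Proof.
move=> /fine_cvgP[bfin /cvgr0Pnorm_lt b0] e e0.
near=> n; rewrite -[b n]fineK; last by near: n.
by rewrite lte_fin; apply: le_lt_trans (ler_norm _) _; near: n; exact: b0.
Unshelve. all: by end_near. Qed.

Lemma cvg_le_ereal (V : normedModType R) (a : nat -> V) (v : V)
    (b : nat -> \bar R) :
  (forall n, (`|v - a n|%:E <= b n)%E) -> b @ \oo --> 0%E -> a @ \oo --> v.
Proof.
move=> ab b0; apply/cvgrPdist_lt => e e0; near=> n.
rewrite -lte_fin; apply: le_lt_trans (ab n) _.
by near: n; exact: cvge0_lt.
Unshelve. all: by end_near. Qed.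

Lemma cvg_ereal_0D (b c : nat -> \bar R) : b @ \oo --> 0%E -> c @ \oo --> 0%E ->
  (fun n => b n + c n)%E @ \oo --> 0%E.
Proof. by move=> b0 c0; rewrite -[0%E]adde0; apply: cvgeD. Qed.

End ErealLimits.

Section BochnerIntegral.
Context d (T : measurableType d) (R : realType).
Variables (mu : {measure set T -> \bar R}) (D : set T).
Hypotheses (mD : measurable D) (muD : (mu D < +oo)%E).

Lemma eq_strongly_measurable (V : normedModType R) (f g : T -> V) :
  (forall x, D x -> f x = g x) ->
  strongly_measurable mu D f -> strongly_measurable mu D g.
Proof.
by move=> fg [s [ss sf]]; exists s; split => // x Dx; rewrite -fg//; exact: sf.
Qed.

Lemma step_strongly_measurable (V : normedModType R) (s : T -> V) :
  step D s -> strongly_measurable mu D s.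
Proof.
move=> ss; exists (fun=> s); split => [n|x _]; last exact: cvg_cst.
exact/simple_mapP.
Qed.

Lemma strongly_measurable_comp2 (V1 V2 V3 : normedModType R)
    (F : V1 -> V2 -> V3) (f : T -> V1) (g : T -> V2) :
  (forall s t v w, s @ \oo --> v -> t @ \oo --> w ->
     (fun n : nat => F (s n) (t n)) @ \oo --> F v w) ->
  strongly_measurable mu D f -> strongly_measurable mu D g ->
  strongly_measurable mu D (fun x => F (f x) (g x)).
Proof.
move=> cF [s [ss sf]] [t [st tg]].
exists (fun n x => F (s n x) (t n x)); split => [n|x Dx].
  apply/simple_mapP => //.
  apply: (@step_comp _ _ _ _ _ (fun w => F w.1 w.2) (fun x => (s n x, t n x))).
  by apply: step_pair; apply/(simple_mapP mD muD).
by apply: cF; [exact: sf|exact: tg].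
Qed.

Lemma measurable_comp2 (V1 V2 : normedModType R)
    (F : V1 -> V2 -> R) (f : T -> V1) (g : T -> V2) :
  (forall s t v w, s @ \oo --> v -> t @ \oo --> w ->
     (fun n : nat => F (s n) (t n)) @ \oo --> F v w) ->
  strongly_measurable mu D f -> strongly_measurable mu D g ->
  measurable_fun D (fun x => F (f x) (g x)).
Proof.
move=> cF [s [ss sf]] [t [st tg]].
apply: (@measurable_fun_cvg _ _ _ _ (fun n x => F (s n x) (t n x))) => [n|x Dx].
  apply: step_measurable_fun.
  apply: (@step_comp _ _ _ _ _ (fun w => F w.1 w.2) (fun x => (s n x, t n x))).
  by apply: step_pair; apply/(simple_mapP mD muD).
by apply: cF; [exact: sf|exact: tg].
Qed.

Lemma strongly_measurable_linear (V : normedModType R) (a : R) (f g : T -> V) :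
  strongly_measurable mu D f -> strongly_measurable mu D g ->
  strongly_measurable mu D (fun x => a *: f x + g x).
Proof.
apply: (@strongly_measurable_comp2 _ _ _ (fun v w => a *: v + w)).
by move=> s t v w sv tw; apply: cvgD => //; exact: cvgZr.
Qed.

Lemma strongly_measurableB (V : normedModType R) (f g : T -> V) :
  strongly_measurable mu D f -> strongly_measurable mu D g ->
  strongly_measurable mu D (fun x => f x - g x).
Proof.
apply: (@strongly_measurable_comp2 _ _ _ (fun v w => v - w)).
by move=> s t v w sv tw; exact: cvgB.
Qed.

Lemma measurable_norm (V : normedModType R) (f : T -> V) :
  strongly_measurable mu D f -> measurable_fun D (fun x => `|f x|).
Proof.
move=> mf; apply: (measurable_comp2 (F := fun v w => `|v|) _ mf mf).
by move=> s t v w sv _; exact: cvg_norm.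
Qed.

Lemma measurable_norm_EFin (V : normedModType R) (f : T -> V) :
  strongly_measurable mu D f -> measurable_fun D (fun x => `|f x|%:E).
Proof. by move=> /measurable_norm mf; exact/measurable_EFinP. Qed.

(** A strongly measurable function is approximated by simple maps bounded by
    twice its norm: wherever an approximant is too large, it is replaced by 0. *)
Lemma simple_approximation (V : normedModType R) (f : T -> V) :
  strongly_measurable mu D f ->
  exists s : nat -> T -> V,
    [/\ forall n, step D (s n),
        forall x, D x -> s ^~ x @ \oo --> f x &
        forall n x, D x -> `|s n x| <= 2 * `|f x|].
Proof.
move=> mf; have [s [ss sf]] := mf.
have st n : step D (s n) by exact/(simple_mapP mD muD).
pose cut (w : V * bool) := if w.2 then w.1 else 0.
exists (fun n x => cut (s n x, `|s n x| <= 2 * `|f x|)); split => [n|x Dx|n x Dx].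
- apply: (@step_comp _ _ _ _ _ cut (fun x => (s n x, `|s n x| <= 2 * `|f x|))).
  apply: step_pair => //; apply: measurable_step_bool => //.
  apply: measurable_fun_le => //.
    exact/measurable_norm/step_strongly_measurable.
  by apply: measurable_funM => //; exact: measurable_norm.
- rewrite /cut/=; have [fx0|fx0] := eqVneq (f x) 0.
    rewrite fx0; apply: cvg_near_cst; apply: nearW => n.
    by rewrite normr0 mulr0 normr_le0; case: eqP.
  have := sf x Dx; apply: cvg_trans; apply: near_eq_cvg.
  have : \forall n \near \oo, `|f x - s n x| < `|f x|.
    by move/cvgrPdist_lt: (sf x Dx); apply; rewrite normr_gt0.
  apply: filterS => n fs; rewrite ifT//.
  rewrite -[s n x](subKr (f x)); apply: le_trans (ler_normB _ _) _.
  by rewrite mulr_natl mulr2n lerD2l ltW.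
- rewrite /cut/=; case: ifPn => //; rewrite normr0 mulr_ge0//.
Qed.

Lemma L1_approximation (V : normedModType R) (f : T -> V) :
  strongly_measurable mu D f -> (\int[mu]_(x in D) `|f x|%:E < +oo)%E ->
  exists s : nat -> T -> V, (forall n, step D (s n)) /\
    (fun n => \int[mu]_(x in D) `|f x - s n x|%:E)%E @ \oo --> 0%E.
Proof.
move=> mf intf; have [s [ss sf sle]] := simple_approximation mf.
exists s; split => //.
have mfs n : measurable_fun D (fun x => `|f x - s n x|%:E).
  apply/measurable_norm_EFin/strongly_measurableB => //.
  exact: step_strongly_measurable.
rewrite -(integral0 mu D).
apply: (@dominated_cvg _ _ _ _ _ mD _ _ (fun x => (3 * `|f x|)%:E)) => //.
- move=> x Dx.
  have : `|f x - s n x| @[n --> \oo] --> (0:R).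
    rewrite -(normr0 V) -(subrr (f x)); apply: cvg_norm; apply: cvgB.
      exact: cvg_cst.
    exact: sf.
  by move=> h; apply: cvg_EFin; [exact: nearW|exact: h].
- apply/integrableP; split.
    by apply/measurable_EFinP; apply: measurable_funM => //; exact: measurable_norm.
  under eq_integral => x _ do rewrite abse_EFin ger0_norm ?mulr_ge0// EFinM.
  rewrite ge0_integralZl//; last exact: measurable_norm_EFin.
  by rewrite lte_mul_pinfty.
- move=> n x Dx.
  rewrite abse_EFin lee_fin ger0_norm//; apply: le_trans (ler_normB _ _) _.
  by have := sle n x Dx; lra.
Qed.

Lemma simple_integral_dist (V : normedModType R) (f s t : T -> V) :
  strongly_measurable mu D f -> step D s -> step D t ->
  (`|simple_integral mu D s - simple_integral mu D t|%:E <=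
    \int[mu]_(x in D) `|f x - s x|%:E + \int[mu]_(x in D) `|f x - t x|%:E)%E.
Proof.
move=> mf ss st.
have ms := step_strongly_measurable ss; have mt := step_strongly_measurable st.
have sts : step D (fun x => -1 *: t x + s x).
  apply: (@step_comp _ _ _ _ _ (fun w => -1 *: w.1 + w.2) (fun x => (t x, s x))).
  exact: step_pair.
have -> : simple_integral mu D s - simple_integral mu D t =
    simple_integral mu D (fun x => -1 *: t x + s x).
  by rewrite simple_integral_linear// scaleN1r addrC.
apply: le_trans (simple_integral_norm mD muD sts) _.
rewrite -ge0_integralD//; last 2 first.
- exact/measurable_norm_EFin/strongly_measurableB.
- exact/measurable_norm_EFin/strongly_measurableB.
apply: ge0_le_integral => //.
- by apply: measurable_norm_EFin; exact: strongly_measurable_linear.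
- by apply: emeasurable_funD; exact/measurable_norm_EFin/strongly_measurableB.
- move=> x Dx; rewrite -EFinD lee_fin scaleN1r addrC.
  rewrite (_ : s x - t x = (f x - t x) - (f x - s x)); last first.
    by rewrite opprB [RHS]addrC addrA subrK.
  by rewrite [leRHS]addrC ler_normB.
Qed.

Lemma bochner_integrable_of_norm (V : completeNormedModType R) (f : T -> V) :
  strongly_measurable mu D f -> (\int[mu]_(x in D) `|f x|%:E < +oo)%E ->
  bochner_integrable mu D f.
Proof.
move=> mf intf; have [s [ss s0]] := L1_approximation mf intf.
have : cvg ((fun n => simple_integral mu D (s n)) @ \oo).
  apply/cauchy_cvgP/cauchy_exP => e e0.
  have e20 : 0 < e / 2 by rewrite divr_gt0.
  have [N _ sN] := cvge0_lt s0 e20.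
  exists (simple_integral mu D (s N)); exists N => // n /= Nn.
  rewrite -ball_normE/= -lte_fin.
  apply: le_lt_trans (simple_integral_dist mf (ss N) (ss n)) _.
  by rewrite [e](splitr e) EFinD; apply: lteD; apply: sN => /=.
move=> /cvg_ex[v sv]; exists v; split => //; exists s; split => // n.
exact/simple_mapP.
Qed.

Lemma has_bochner_integral_unique (V : normedModType R) (f : T -> V) v w :
  has_bochner_integral mu D f v -> has_bochner_integral mu D f w -> v = w.
Proof.
move=> [mf [s [ss s0 sv]]] [_ [t [st t0 tw]]].
apply/eqP; rewrite -subr_eq0; apply/eqP.
apply: (@cvg_unique _ _ ((fun n => simple_integral mu D (s n) -
                           simple_integral mu D (t n)) @ \oo)) => //.
  exact: cvgB.
apply: cvg_le_ereal (cvg_ereal_0D s0 t0) => n.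
rewrite sub0r normrN.
by apply: simple_integral_dist => //; exact/(simple_mapP mD muD).
Qed.

Lemma bochnerE (V : normedModType R) (f : T -> V) v :
  has_bochner_integral mu D f v -> bochner mu D f = v.
Proof.
move=> fv; apply: xget_unique => // w fw; exact: has_bochner_integral_unique fw fv.
Qed.

Lemma bochner_integral_correct (V : normedModType R) (f : T -> V) :
  bochner_integrable mu D f -> has_bochner_integral mu D f (bochner mu D f).
Proof. by move=> [v fv]; rewrite (bochnerE fv). Qed.

Lemma eq_has_bochner_integral (V : normedModType R) (f g : T -> V) v :
  (forall x, D x -> f x = g x) ->
  has_bochner_integral mu D f v -> has_bochner_integral mu D g v.
Proof.
move=> fg [mf [s [ss s0 sv]]]; split; first exact: eq_strongly_measurable mf.
exists s; split => //; apply: cvg_trans s0; apply: near_eq_cvg; near=> n.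
by apply: eq_integral => x; rewrite inE => Dx; rewrite fg.
Unshelve. all: by end_near. Qed.

Lemma has_bochner_integral_linear (V : normedModType R) (a : R)
    (f g : T -> V) v w :
  has_bochner_integral mu D f v -> has_bochner_integral mu D g w ->
  has_bochner_integral mu D (fun x => a *: f x + g x) (a *: v + w).
Proof.
move=> [mf [s [ss s0 sv]]] [mg [t [st t0 tw]]].
have ss' n : step D (s n) by exact/(simple_mapP mD muD).
have st' n : step D (t n) by exact/(simple_mapP mD muD).
have ms n := step_strongly_measurable (ss' n).
have mt n := step_strongly_measurable (st' n).
split; first exact: strongly_measurable_linear.
exists (fun n x => a *: s n x + t n x); split.
- move=> n; apply/simple_mapP => //.
  apply: (@step_comp _ _ _ _ _ (fun w => a *: w.1 + w.2) (fun x => (s n x, t n x))).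
  exact: step_pair.
- apply: (@squeeze_cvge _ _ _ _ (fun=> 0%E) _ (fun n =>
    `|a|%:E * \int[mu]_(x in D) `|f x - s n x|%:E +
    \int[mu]_(x in D) `|g x - t n x|%:E)%E).
  + apply: nearW => n; rewrite integral_ge0//=.
    rewrite -ge0_integralZl//; last first.
      exact/measurable_norm_EFin/strongly_measurableB.
    rewrite -ge0_integralD//; last 2 first.
    * by apply: measurable_funeM; exact/measurable_norm_EFin/strongly_measurableB.
    * exact/measurable_norm_EFin/strongly_measurableB.
    apply: ge0_le_integral => //.
    * apply/measurable_norm_EFin/strongly_measurableB; exact: strongly_measurable_linear.
    * apply: emeasurable_funD; last exact/measurable_norm_EFin/strongly_measurableB.
      by apply: measurable_funeM; exact/measurable_norm_EFin/strongly_measurableB.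
    * move=> x Dx; rewrite -EFinM -EFinD lee_fin -normrZ opprD addrACA -scalerBr.
      exact: ler_normD.
  + exact: cvg_cst.
  + apply: cvg_ereal_0D => //; rewrite -(mule0 `|a|%:E).
    exact: cvgeZl.
- under eq_fun => n do rewrite simple_integral_linear//.
  by apply: cvgD => //; exact: cvgZr.
Qed.

Lemma bochner_norm (V : normedModType R) (f : T -> V) v :
  has_bochner_integral mu D f v -> (`|v|%:E <= \int[mu]_(x in D) `|f x|%:E)%E.
Proof.
move=> [mf [s [ss s0 sv]]].
have ss' n : step D (s n) by exact/(simple_mapP mD muD).
have ms n := step_strongly_measurable (ss' n).
apply/lee_addgt0Pr => e e0.
have e20 : 0 < e / 2 by rewrite divr_gt0.
have [n [sn vn]] : exists n, (\int[mu]_(x in D) `|f x - s n x|%:E < (e / 2)%:E)%E /\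
    `|v - simple_integral mu D (s n)| < e / 2.
  near \oo => n; exists n; split; near: n; first exact: cvge0_lt.
  by move/cvgrPdist_lt: sv; apply.
rewrite -[v](subrK (simple_integral mu D (s n))).
have : (`|simple_integral mu D (s n)|%:E <=
    \int[mu]_(x in D) `|f x|%:E + (e / 2)%:E)%E.
  apply: le_trans (simple_integral_norm mD muD (ss' n)) _.
  apply: (@le_trans _ _ (\int[mu]_(x in D) `|f x|%:E +
                         \int[mu]_(x in D) `|f x - s n x|%:E)%E).
    rewrite -ge0_integralD//; last 2 first.
    - exact: measurable_norm_EFin.
    - exact/measurable_norm_EFin/strongly_measurableB.
    apply: ge0_le_integral => //.
    - exact: measurable_norm_EFin.
    - apply: emeasurable_funD; first exact: measurable_norm_EFin.
      exact/measurable_norm_EFin/strongly_measurableB.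
    - move=> x Dx; rewrite -EFinD lee_fin.
      by rewrite -{1}[s n x](subKr (f x)) ler_normB.
  by rewrite leeD2l// ltW.
move=> sle.
have vnE : (`|v - simple_integral mu D (s n)|%:E <= (e / 2)%:E)%E.
  by rewrite lee_fin ltW.
have -> : (\int[mu]_(x in D) `|f x|%:E + e%:E =
    (e / 2)%:E + (\int[mu]_(x in D) `|f x|%:E + (e / 2)%:E))%E.
  by rewrite addeCA -EFinD -splitr.
apply: le_trans (leeD vnE sle); rewrite -EFinD lee_fin; exact: ler_normD.
Unshelve. all: by end_near. Qed.

End BochnerIntegral.

(** * The L^p norm of scalar functions *)

Section ScalarLpNorm.
Context d (T : measurableType d) (R : realType).
Variable mu : {measure set T -> \bar R}.
Local Notation "'N_ p [ f ]" := (Lnorm mu p (EFin \o f)).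

Lemma cvg_powR_norm (p l : R) (u : nat -> R) : 0 < p -> u @ \oo --> l ->
  (fun n => `|u n| `^ p) @ \oo --> `|l| `^ p.
Proof.
move=> p0 ul; have nul : (fun n => `|u n|) @ \oo --> `|l| by exact: cvg_norm.
have [l0|l0] := eqVneq `|l| 0; last first.
  have lp : 0 < `|l| by rewrite lt0r l0 normr_ge0.
  apply: (@continuous_cvg _ _ _ _ _ _ (fun x : R => x `^ p)) => //.
  apply: differentiable_continuous; apply/derivable1_diffP.
  exact: (@ex_derive _ _ _ _ _ _ _ (is_derive1_powR p lp)).
rewrite l0 powR0 ?gt_eqF//; rewrite l0 in nul.
apply/cvgr0Pnorm_le => e e0; near=> n.
rewrite ger0_norm ?powR_ge0//.
rewrite -[e]powRr1 ?(ltW e0)// -(@mulVf _ p) ?gt_eqF// powRrM.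
apply: ge0_ler_powR; rewrite ?nnegrE ?powR_ge0 ?(ltW p0)//.
near: n; have ep : 0 < e `^ p^-1 by rewrite powR_gt0.
move/cvgr0Pnorm_le: nul => /(_ _ ep); apply: filterS => n.
by rewrite normr_id.
Unshelve. all: by end_near. Qed.

Lemma measurable_powR_norm (p : R) (D : set T) (f : T -> R) :
  measurable_fun D f -> measurable_fun D (fun x => (`|f x| `^ p)%:E).
Proof.
move=> mf; apply/measurable_EFinP.
apply: (@measurableT_comp _ _ _ _ _ _ (@powR R ^~ p)) => //.
exact: measurableT_comp.
Qed.

Lemma Lnorm_powRE (p : R) (f : T -> R) :
  'N_p%:E[f] = ((\int[mu]_x (`|f x| `^ p)%:E) `^ p^-1)%E.
Proof. by rewrite unlock. Qed.

Lemma poweR_le_mono (p : R) (x y : \bar R) : 0 < p -> (0 <= x)%E ->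
  (x <= y)%E -> (x `^ p <= y `^ p)%E.
Proof.
move=> p0 x0 xy; apply: gt0_ler_poweR => //; first exact: ltW.
- by rewrite in_itv/= leey andbT.
- by rewrite in_itv/= leey andbT (le_trans x0).
Qed.

Lemma integral_powR_ge0 (p : R) (D : set T) (f : T -> R) :
  (0 <= \int[mu]_(x in D) (`|f x| `^ p)%:E)%E.
Proof. by apply: integral_ge0 => x _; rewrite lee_fin powR_ge0. Qed.

Lemma Lnorm_le_ae (p : \bar R) (f g : T -> R) : (0 < p)%E ->
  measurable_fun setT f -> measurable_fun setT g ->
  {ae mu, forall x, `|f x| <= `|g x|} -> ('N_p[f] <= 'N_p[g])%E.
Proof.
move=> p0 mf mg fg; case: p p0 => [p p0|_|//].
- rewrite lte_fin in p0; rewrite !Lnorm_powRE.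
  apply: poweR_le_mono; [by rewrite invr_gt0|exact: integral_powR_ge0|].
  apply: ae_ge0_le_integral => //=.
  + exact: measurable_powR_norm.
  + exact: measurable_powR_norm.
  + apply: filterS fg => x fgx _.
    by rewrite lee_fin ge0_ler_powR ?nnegrE// ltW.
- rewrite unlock; case: ifPn => // _; apply: le_ess_sup.
  by apply: filterS fg => x /=; rewrite lee_fin.
Qed.

(** Fatou's lemma for L^p norms, including [p = +oo]. *)
Lemma Lnorm_fatou (p c : \bar R) (g_ : nat -> T -> R) (g : T -> R) : (0 < p)%E ->
  (forall n, measurable_fun setT (g_ n)) -> measurable_fun setT g ->
  {ae mu, forall x, g_ ^~ x @ \oo --> g x} ->
  (forall n, 'N_p[g_ n] <= c)%E -> ('N_p[g] <= c)%E.
Proof.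
move=> p0 mg_ mg gg; have [N [mN N0 subN]] := gg.
have NC x : (~` N) x -> g_ ^~ x @ \oo --> g x.
  by move=> Nx; apply: contrapT => h; apply: Nx; exact: subN.
case: p p0 => [p p0|_|//] gc.
- rewrite lte_fin in p0.
  have c0 : (0 <= c)%E by apply: le_trans (gc 0%N); exact: Lnorm_ge0.
  have gc' n : (\int[mu]_x (`|g_ n x| `^ p)%:E <= c `^ p)%E.
    rewrite -[leLHS]poweRe1 ?integral_powR_ge0//.
    rewrite -(@mulVf _ p) ?gt_eqF// poweRrM.
    apply: poweR_le_mono; rewrite ?poweR_ge0//.
    by rewrite -Lnorm_powRE.
  rewrite Lnorm_powRE -[c]poweRe1// -(@mulfV _ p) ?gt_eqF// poweRrM.
  apply: poweR_le_mono; [by rewrite invr_gt0|exact: integral_powR_ge0|].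
  have mN' : measurable (~` N) by exact: measurableC.
  rewrite (@ge0_negligible_integral _ _ _ _ _ N)//; last exact: measurable_powR_norm.
  rewrite setTD.
  have -> : (\int[mu]_(x in ~` N) (`|g x| `^ p)%:E =
      \int[mu]_(x in ~` N) limn_einf (fun n => (`|g_ n x| `^ p)%:E))%E.
    apply: eq_integral => x /[1!inE] Nx.
    apply/esym/(cvg_limn_einf_sup _).1.
    apply: cvg_EFin; first exact: nearW.
    by apply: cvg_powR_norm => //; exact: NC.
  apply: le_trans (fatou _ _ _ _) _ => //.
    by move=> n; apply: measurable_powR_norm; exact: measurable_funTS.
  rewrite limn_einf_lim; apply: lime_le; first exact: is_cvg_einfs.
  apply: nearW => n; apply: (@le_trans _ _ (\int[mu]_(x in ~` N) (`|g_ n x| `^ p)%:E)%E).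
    by apply: ereal_inf_lbound; exists n => /=.
  apply: le_trans (gc' n); apply: ge0_subset_integral => //.
  exact: measurable_powR_norm.
- move: gc; rewrite unlock; case: ifPn => [_ gc|_ /(_ 0%N)//].
  apply/ess_supP.
  have : \forall x \ae mu, forall n, (`|(g_ n x)%:E| <= c)%E.
    by apply/ae_foralln => n; apply/ess_supP; exact: gc.
  apply: filterS2 gg => x gx gxc /=.
  apply: (@cvge_to_le _ \oo _ _ (fun n => `|(g_ n x)%:E|%E)).
    by apply: cvg_EFin; [exact: nearW|exact: cvg_norm].
  exact: nearW.
Qed.

Lemma LnormZ_finite (p : \bar R) (a : R) (f : T -> R) : (1 <= p)%E ->
  measurable_fun setT f -> finite_norm mu p f ->
  'N_p[(fun x => a * f x)] = (`|a|%:E * 'N_p[f])%E.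
Proof.
move=> p1 mf ff.
have fL : f \in Lfun mu p by rewrite inE/=; apply/andP; split; rewrite inE.
exact: (LnormZ (Lfun_Sub p1 fL) a).
Qed.

(** Hoelder's inequality, including the exponent [p = +oo]. *)
Lemma hoelder_extended (p : \bar R) (q : R) (w f : T -> R) :
  (0 < p)%E -> 0 < q -> (p^-1 + (q^-1)%:E = 1)%E ->
  measurable_fun setT w -> measurable_fun setT f ->
  (\int[mu]_x `|w x * f x|%:E <= 'N_q%:E[w] * 'N_p[f])%E.
Proof.
move=> + q0 + mw mf; case: p => [p p0 pq|_ pq|//].
- rewrite lte_fin in p0.
  have := hoelder mu mw mf q0 p0; rewrite Lnorm1; apply.
  by move: pq; rewrite inver gt_eqF// => -[]; rewrite addrC.
- have -> : q = 1.
    by move: pq; rewrite invey add0e => -[] /(congr1 GRing.inv); rewrite invrK invr1.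
  have -> : 'N_1[w] = (\int[mu]_x `|w x|%:E)%E by rewrite Lnorm1.
  have mw' : measurable_fun setT (fun x => `|w x|%:E).
    by apply/measurable_EFinP; exact: measurableT_comp.
  have f0 : (0 <= 'N_+oo[f])%E by exact: Lnorm_ge0.
  rewrite -ge0_integralZr//.
  apply: ae_ge0_le_integral => //=.
  + by apply/measurable_EFinP; apply: measurableT_comp => //; exact: measurable_funM.
  + by move=> x _; exact: mule_ge0.
  + by apply: emeasurable_funM => //; exact: measurable_cst.
  have : {ae mu, forall x, (`|(f x)%:E| <= 'N_+oo[f])%E}.
    rewrite unlock; case: ifPn => [_|]; first exact: ess_sup_ge.
    rewrite -leNgt => mu0; exists setT; split => //.
    by apply/eqP; rewrite eq_le mu0/=.
  apply: filterS => x fx _; rewrite normrM EFinM.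
  exact: lee_wpmul2l.
Qed.

End ScalarLpNorm.

(** * L^p spaces of vector-valued functions *)

Section VectorLp.
Context d (T : measurableType d) (R : realType).
Variables (mu : {measure set T -> \bar R}) (D : set T).
Hypotheses (mD : measurable D) (muD : (mu D < +oo)%E).
Variable p : \bar R.
Hypothesis p1 : (1 <= p)%E.

Let p0 : (0 < p)%E. Proof. exact: lt_le_trans p1. Qed.

Local Notation nrm f := ((fun x => `|f x|%R) \_ D).
Local Notation "'N_ p [ f ]" := (Lnorm mu p (EFin \o f)).

Lemma measurable_nrm (V : normedModType R) (f : T -> V) :
  strongly_measurable mu D f -> measurable_fun setT (nrm f).
Proof. by move=> mf; apply/(measurable_restrictT _ mD); exact: (measurable_norm mD muD mf). Qed.

Lemma nrmE (V : normedModType R) (f : T -> V) x :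
  (nrm f) x = if x \in D then `|f x| else 0.
Proof. by rewrite patchE. Qed.

Lemma LpnormE (V : normedModType R) (f : T -> V) : Lp mu D p f ->
  'N_p[nrm f] = (Lpnorm mu D p f)%:E.
Proof.
by move=> [_ ff]; rewrite fineK// ge0_fin_numE ?Lnorm_ge0.
Qed.

Lemma Lpnorm_ge0 (V : normedModType R) (f : T -> V) : 0 <= Lpnorm mu D p f.
Proof. by rewrite fine_ge0// Lnorm_ge0. Qed.

Lemma Lp_normZ (V : normedModType R) (a : R) (f : T -> V) : Lp mu D p f ->
  'N_p[nrm (a *: f)] = (`|a| * Lpnorm mu D p f)%:E.
Proof.
move=> fp; have [mf ff] := fp.
rewrite EFinM -LpnormE// -[in RHS]normr_id -LnormZ_finite//; last exact: measurable_nrm.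
congr (Lnorm _ _ (EFin \o _)); apply/funext => x.
by rewrite !nrmE; case: ifPn; rewrite ?mulr0// => _; rewrite -normrZ.
Qed.

Lemma Lp_norm_triangle (V : normedModType R) (f g : T -> V) :
  strongly_measurable mu D f -> strongly_measurable mu D g ->
  ('N_p[nrm (f + g)] <= 'N_p[nrm f] + 'N_p[nrm g])%E.
Proof.
move=> mf mg; have mnf := measurable_nrm mf; have mng := measurable_nrm mg.
apply: le_trans (eminkowski mu mnf mng p1).
apply: Lnorm_le_ae => //.
- apply: measurable_nrm.
  apply: (eq_strongly_measurable _ (strongly_measurable_linear mD muD 1 mf mg)).
  by move=> x _; rewrite scale1r.
- exact: measurable_funD.
- apply: aeW => x; rewrite /= !nrmE; case: ifPn => _; last by rewrite addr0.
  rewrite normr_id ger0_norm ?addr_ge0//; exact: ler_normD.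
Qed.

Lemma Lp_linear (V : normedModType R) (a : R) (f g : T -> V) :
  Lp mu D p f -> Lp mu D p g -> Lp mu D p (a *: f + g).
Proof.
move=> fp gp; have [mf ff] := fp; have [mg fg] := gp.
split; first exact: strongly_measurable_linear.
have maf : strongly_measurable mu D (a *: f).
  have := strongly_measurable_linear mD muD (a - 1) mf mf.
  by apply: eq_strongly_measurable => x _; rewrite scalerBl scale1r subrK.
apply: le_lt_trans (Lp_norm_triangle maf mg) _.
by rewrite Lp_normZ// LpnormE// -EFinD ltry.
Qed.

Lemma Lp0 (V : normedModType R) : Lp mu D p (0 : T -> V).
Proof.
split.
  apply: step_strongly_measurable => //; split.
    apply: (@sub_finite_set _ _ [set 0]); last exact: finite_set1.
    by move=> _ [x _ <-].
  move=> v; have [v0|v0] := eqVneq (0 : V) v.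
    rewrite (_ : _ `&` _ = D)//; apply/seteqP; split => [x []//|x Dx]; split => //.
  rewrite (_ : _ `&` _ = set0)//; apply/seteqP; split => // x [_ /= /eqP].
  by rewrite (negbTE v0).
rewrite /finite_norm (_ : EFin \o _ = cst 0%E) ?Lnorm0 ?gt_eqF//.
by apply/funext => x /=; rewrite nrmE normr0 if_same.
Qed.

Lemma LpZ (V : normedModType R) (a : R) (f : T -> V) :
  Lp mu D p f -> Lp mu D p (a *: f).
Proof. by move=> fp; rewrite -[_ *: _]addr0; apply: Lp_linear => //; exact: Lp0. Qed.

Lemma LpD (V : normedModType R) (f g : T -> V) :
  Lp mu D p f -> Lp mu D p g -> Lp mu D p (f + g).
Proof. by move=> fp gp; rewrite -[f]scale1r; exact: Lp_linear. Qed.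

Lemma LpN (V : normedModType R) (f : T -> V) : Lp mu D p f -> Lp mu D p (- f).
Proof. by move=> fp; rewrite -scaleN1r; exact: LpZ. Qed.

Lemma LpB (V : normedModType R) (f g : T -> V) :
  Lp mu D p f -> Lp mu D p g -> Lp mu D p (f - g).
Proof. by move=> fp gp; apply: LpD => //; exact: LpN. Qed.

Lemma LpnormZ (V : normedModType R) (a : R) (f : T -> V) : Lp mu D p f ->
  Lpnorm mu D p (a *: f) = `|a| * Lpnorm mu D p f.
Proof. by move=> fp; rewrite {1}/Lpnorm Lp_normZ. Qed.

Lemma LpnormD (V : normedModType R) (f g : T -> V) : Lp mu D p f -> Lp mu D p g ->
  Lpnorm mu D p (f + g) <= Lpnorm mu D p f + Lpnorm mu D p g.
Proof.
move=> fp gp; rewrite -lee_fin EFinD -!LpnormE//; last exact: LpD.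
by apply: Lp_norm_triangle; [case: fp|case: gp].
Qed.

Lemma Lpnorm_eq0 (V : normedModType R) (f : T -> V) : Lp mu D p f ->
  Lpnorm mu D p f = 0 -> ae_equal mu D f 0.
Proof.
move=> fp f0; have [mf _] := fp.
have mnf : measurable_fun setT (EFin \o (nrm f)).
  by apply/measurable_EFinP; exact: measurable_nrm.
have : 'N_p[nrm f] = 0%E by rewrite LpnormE// f0.
move=> /(Lnorm_eq0_eq0 mnf p0); apply: filterS => x /(_ I) /= [].
by rewrite nrmE => + Dx; rewrite mem_set// => /normr0_eq0.
Qed.

(** L^p balls are closed under convergence almost everywhere. *)
Lemma Lp_fatou (V : normedModType R) (c : R) (f_ : nat -> T -> V) (f : T -> V) :
  (forall n, Lp mu D p (f_ n)) -> strongly_measurable mu D f ->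
  {ae mu, forall x, D x -> f_ ^~ x @ \oo --> f x} ->
  (forall n, Lpnorm mu D p (f_ n) <= c) ->
  Lp mu D p f /\ Lpnorm mu D p f <= c.
Proof.
move=> fp mf ff fc.
have fc' : ('N_p[nrm f] <= c%:E)%E.
  apply: (@Lnorm_fatou _ _ _ _ _ _ (fun n => nrm (f_ n))) => //.
  - by move=> n; apply: measurable_nrm; case: (fp n).
  - exact: measurable_nrm.
  - apply: filterS ff => x fx; under eq_fun => n do rewrite nrmE.
    rewrite nrmE; case: ifPn => xD; last exact: cvg_cst.
    by apply: cvg_norm; apply: fx; rewrite inE in xD.
  - by move=> n; rewrite LpnormE// lee_fin.
have fp' : Lp mu D p f by split => //; exact: le_lt_trans fc' (ltry _).
by split => //; rewrite -lee_fin -LpnormE.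
Qed.

Section Hoelder.
Variable q : R.
Hypotheses (q0 : 0 < q) (pq : (p^-1 + (q^-1)%:E = 1)%E).

(** Hoelder's inequality for a scalar weight, with conjugate exponents [p] and
    [q]; [q] is finite, hence [p > 1]. *)
Lemma Lp_hoelder (V : normedModType R) (w : T -> R) (f : T -> V) :
  measurable_fun D w -> ('N_q%:E[w \_ D] < +oo)%E -> Lp mu D p f ->
  (\int[mu]_(x in D) (`|w x| * `|f x|)%:E <=
     (fine 'N_q%:E[w \_ D] * Lpnorm mu D p f)%:E)%E.
Proof.
move=> mw wfin fp; have [mf _] := fp.
rewrite EFinM -LpnormE// fineK; last by rewrite ge0_fin_numE ?Lnorm_ge0.
have mwD : measurable_fun setT (w \_ D) by exact/(measurable_restrictT _ mD).
have := hoelder_extended mu p0 q0 pq mwD (measurable_nrm mf).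
apply: le_trans.
rewrite integral_mkcond; apply: ge0_le_integral => //.
- by move=> x _; rewrite patchE; case: ifPn => // _; rewrite lee_fin mulr_ge0.
- apply/(measurable_restrictT _ mD)/measurable_EFinP.
  by apply: measurable_funM; [exact: measurableT_comp|exact: (measurable_norm mD muD mf)].
- apply/measurable_EFinP; apply: measurableT_comp => //.
  by apply: measurable_funM => //; exact: measurable_nrm.
- move=> x _; rewrite !patchE; case: ifPn => _; last by rewrite mul0r normr0.
  by rewrite normrM normr_id.
Qed.

Lemma Lp_L1 (V : normedModType R) : exists2 C : R, 0 <= C &
  forall f : T -> V, Lp mu D p f ->
    (\int[mu]_(x in D) `|f x|%:E <= (C * Lpnorm mu D p f)%:E)%E.
Proof.
exists (fine 'N_q%:E[((fun=> 1) : T -> R) \_ D]); first by rewrite fine_ge0// Lnorm_ge0.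
move=> f fp; have := @Lp_hoelder _ (fun=> 1) f (measurable_cst _) _ fp.
under [in X in (_ -> X) -> _]eq_integral => x _ do rewrite normr1 mul1r.
apply; rewrite Lnorm_powRE poweR_lty//.
have -> : (fun x => (`|(((fun=> 1) : T -> R) \_ D) x| `^ q)%:E) = (fun x => (\1_D x)%:E).
  apply/funext => x; rewrite patchE indicE; case: ifPn => _.
    by rewrite normr1 powR1.
  by rewrite normr0 powR0// gt_eqF.
by rewrite integral_indic// setIT.
Qed.

End Hoelder.
Lemma Lp_seminorm (V : normedModType R) :
  seminorm_on (Lp mu D p : set (T -> V)) (Lpnorm mu D p).
Proof.
split; [exact: Lp0|move=> a x y; exact: Lp_linear|by move=> x _; exact: Lpnorm_ge0
  |move=> a x; exact: LpnormZ|move=> x y; exact: LpnormD].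
Qed.

End VectorLp.

(** * Completeness of L^p *)

Section LpCompleteness.
Context d (T : measurableType d) (R : realType).
Variables (mu : {measure set T -> \bar R}) (D : set T).
Hypotheses (mD : measurable D) (muD : (mu D < +oo)%E).
Variables (p : \bar R) (q : R).
Hypotheses (p1 : (1 <= p)%E) (q0 : 0 < q) (pq : (p^-1 + (q^-1)%:E = 1)%E).
Variable V : completeNormedModType R.
Variable f_ : nat -> T -> V.
Hypotheses (fp : forall n, Lp mu D p (f_ n))
  (f_cauchy : forall n, Lpnorm mu D p (f_ n.+1 - f_ n) <= 2^-1 ^+ n).

Let mf n : strongly_measurable mu D (f_ n). Proof. by case: (fp n). Qed.

(** Simple maps summably close to the [f_ n] in L^1. *)
Lemma summable_simple_approximation : exists s : nat -> T -> V, (forall n, step D (s n)) /\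
  forall n, (\int[mu]_(x in D) `|f_ n x - s n x|%:E <= (2^-1 ^+ n)%:E)%E.
Proof.
have [C C0 CL1] := Lp_L1 mD muD p1 q0 pq V.
have /choice[s ss] n : exists s, step D s /\
    (\int[mu]_(x in D) `|f_ n x - s x|%:E <= (2^-1 ^+ n)%:E)%E.
  have [s [ss s0]] := L1_approximation mD muD (mf n) (le_lt_trans (CL1 _ (fp n)) (ltry _)).
  have h0 : (0 : R) < 2^-1 ^+ n by rewrite exprn_gt0.
  have [N _ /(_ N (leqnn _)) sN] := cvge0_lt s0 h0.
  by exists (s N); split => //; exact: ltW.
by exists s; split => n; case: (ss n).
Qed.

(** The rapidly Cauchy sequence has an almost everywhere limit that is strongly
    measurable: simple maps [s n] that are summably close to [f_ n] in L^1 have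
    the same limit on a measurable set of full measure; outside of this set the
    limit is put equal to 0. *)
Lemma ae_limit : exists2 f : T -> V, strongly_measurable mu D f &
  {ae mu, forall x, D x -> f_ ^~ x @ \oo --> f x}.
Proof.
have [C C0 CL1] := Lp_L1 mD muD p1 q0 pq V.
have [s [ss sf]] := summable_simple_approximation.
have ms n := step_strongly_measurable mD muD (ss n).
pose a n x := `|f_ n.+1 x - f_ n x| + `|f_ n x - s n x|.
have m1 n : measurable_fun D (fun x => `|f_ n.+1 x - f_ n x|%:E).
  exact: (measurable_norm_EFin mD muD (strongly_measurableB mD muD (mf _) (mf _))).
have m2 n : measurable_fun D (fun x => `|f_ n x - s n x|%:E).
  exact: (measurable_norm_EFin mD muD (strongly_measurableB mD muD (mf _) (ms _))).
have ma n : measurable_fun D (fun x => (a n x)%:E).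
  by rewrite /a; under eq_fun do rewrite EFinD; exact: emeasurable_funD.
have a0 n x : 0 <= a n x by rewrite addr_ge0.
have inta n : (\int[mu]_(x in D) (a n x)%:E <=
    (2 * (C + 1) / (2 ^ n.+1)%:R)%:E)%E.
  rewrite /a; under eq_integral do rewrite EFinD.
  rewrite ge0_integralD//.
  apply: (@le_trans _ _ ((C * 2^-1 ^+ n)%:E + (2^-1 ^+ n)%:E)%E).
    apply: leeD => //.
    apply: le_trans (CL1 (f_ n.+1 - f_ n) (LpB mD muD p1 (fp _) (fp _))) _.
    by rewrite lee_fin ler_wpM2l.
  rewrite -EFinD lee_fin natrX exprVn exprS invfM.
  by move: (_ ^- _) => t; lra.
pose G x := (\sum_(n <oo) (a n x)%:E)%E.
have G0 x : (0 <= G x)%E by apply: nneseries_ge0 => n _ _; rewrite lee_fin.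
have mG : measurable_fun D G.
  by apply: ge0_emeasurable_sum => // n x Dx _; rewrite lee_fin.
have intG : mu.-integrable D G.
  apply/integrableP; split => //.
  under eq_integral => x _ do rewrite gee0_abs//.
  rewrite /G integral_nneseries//; last by move=> n x _; rewrite lee_fin.
  apply: le_lt_trans (_ : (\sum_(n <oo) (2 * (C + 1) / (2 ^ n.+1)%:R)%:E < +oo)%E).
    by apply: lee_nneseries => // n _; rewrite integral_ge0// => x _; rewrite lee_fin.
  apply: le_lt_trans (epsilon_trick0 xpredT _) (ltry _).
  by rewrite mulr_ge0// addr_ge0.
pose E := D `&` [set x | G x \is a fin_num].
have mE : measurable E by exact: emeasurable_fin_num.
have aE x : E x -> cvgn (series (a ^~ x)).
  move=> [Dx /= Gx]; apply: nnseries_is_cvg => //.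
  by move: Gx; rewrite ge0_fin_numE.
have fE x : E x -> cvgn (f_ ^~ x).
  move=> Ex; have : cvgn (series (telescope (f_ ^~ x))).
    apply: normed_cvg; apply: series_le_cvg (aE x Ex) => // n.
      exact: normr_ge0.
    by rewrite /telescope/= /a lerDl.
  rewrite telescopeK => h.
  have -> : f_ ^~ x = (fun n => (f_ n x - f_ 0%N x) + f_ 0%N x).
    by apply/funext => n; rewrite subrK.
  apply: is_cvgD; [exact: h|exact: is_cvg_cst].
have sE x : E x -> s ^~ x @ \oo --> lim (f_ ^~ x @ \oo).
  move=> Ex; have -> : s ^~ x = (fun n => f_ n x - (f_ n x - s n x)).
    by apply/funext => n; rewrite subKr.
  rewrite -[X in _ --> X]subr0; apply: cvgB; first exact: fE.
  have h := cvg_series_cvg_0 (aE x Ex).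
  apply/cvgr0Pnorm_lt => e e0; move/cvgr0Pnorm_lt: h => /(_ e e0).
  apply: filterS => n; apply: le_lt_trans.
  by rewrite (ger0_norm (a0 n x)) /a lerDr.
exists (fun x => if x \in E then lim (f_ ^~ x @ \oo) else 0).
  exists (fun n x => if x \in E then s n x else 0); split => [n|x Dx].
    apply/simple_mapP => //.
    apply: (@step_comp _ _ _ _ _ (fun w : V * bool => if w.2 then w.1 else 0)
      (fun x => (s n x, x \in E))).
    apply: step_pair => //; apply: measurable_step_bool => //.
    rewrite (_ : _ `&` _ = E)//; apply/seteqP; split => x /=.
      by move=> [_]; rewrite inE.
    by move=> Ex; split; [case: Ex|rewrite inE].
  case: ifPn => [|_]; last exact: cvg_cst.
  by rewrite inE => /sE.
have := integrable_ae mD intG; apply: filterS => x Gx Dx.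
have Ex : E x by split => //; exact: Gx.
by rewrite mem_set//; exact: fE.
Qed.

Theorem Lp_complete : exists f : T -> V, Lp mu D p f /\
  forall n, Lpnorm mu D p (f - f_ n) <= 2 * 2^-1 ^+ n.
Proof.
have [f msf ff] := ae_limit.
have key n : Lp mu D p (f - f_ n) /\ Lpnorm mu D p (f - f_ n) <= 2 * 2^-1 ^+ n.
  apply: (@Lp_fatou _ _ _ _ _ mD muD _ p1 _ _ (fun k => f_ (n + k)%N - f_ n)).
  - by move=> k; exact: LpB.
  - exact: strongly_measurableB.
  - apply: filterS ff => x fx Dx; apply: cvgB; last exact: cvg_cst.
    have := fx Dx; rewrite -(cvg_shiftn n); apply: cvg_trans.
    by under eq_fun do rewrite addnC.
  - by move=> k; exact: (rapid_dist (Lp_seminorm mD muD p1 V) fp).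
exists f; split => [|n]; last by case: (key n).
rewrite -[f](subrK (f_ 0%N)); apply: LpD => //; by case: (key 0%N).
Qed.

End LpCompleteness.

(** * The inner product of L^2 *)

Section InnerProduct.
Context (R : realType) (U : normedModType R) (ip : {dot U for idfun}).
Hypothesis hip : inner_product_norm ip.

Lemma ipC (x y : U) : ip x y = ip y x.
Proof. by rewrite (@hermC _ _ _ _ ip x y) /= expr0 mul1r. Qed.

Lemma ip_linear (a : R) (x y z : U) : ip (a *: x + y) z = a * ip x z + ip y z.
Proof. by rewrite linearDl/= linearZl_LR. Qed.

Lemma sqr_normD (x y : U) : `|x + y| ^+ 2 = `|x| ^+ 2 + 2 * ip x y + `|y| ^+ 2.
Proof.
rewrite !hip -{1}[x]scale1r ip_linear [ip x _]ipC [ip y _]ipC.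
rewrite -{1 3}[x]scale1r !ip_linear [ip y x]ipC; ring.
Qed.

Lemma sqr_normB (x y : U) : `|x - y| ^+ 2 = `|x| ^+ 2 - 2 * ip x y + `|y| ^+ 2.
Proof. by rewrite sqr_normD normrN linearNr mulrN. Qed.

(** Continuity and the bound of the inner product are read off its expression
    through norms. *)
Lemma ip_polarization (x y : U) : ip x y = (`|x + y| ^+ 2 - `|x - y| ^+ 2) / 4.
Proof. by rewrite sqr_normD sqr_normB; field. Qed.

Lemma cvg_ip (s t : nat -> U) v w : s @ \oo --> v -> t @ \oo --> w ->
  (fun n => ip (s n) (t n)) @ \oo --> ip v w.
Proof.
move=> sv tw; under eq_fun do rewrite ip_polarization.
rewrite ip_polarization; apply: cvgMl; apply: cvgB.
  by under eq_fun do rewrite expr2; rewrite expr2;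
    apply: cvgM; apply: cvg_norm; exact: cvgD.
by under eq_fun do rewrite expr2; rewrite expr2;
  apply: cvgM; apply: cvg_norm; exact: cvgB.
Qed.

Lemma norm_ip_le (x y : U) : `|ip x y| <= (`|x| ^+ 2 + `|y| ^+ 2) / 2.
Proof.
have := sqr_ge0 `|x + y|; have := sqr_ge0 `|x - y|.
rewrite sqr_normB sqr_normD ler_norml; lra.
Qed.

Context d (T : measurableType d).
Variables (mu : {measure set T -> \bar R}) (D : set T).
Hypotheses (mD : measurable D) (muD : (mu D < +oo)%E).

Local Notation L2 := (Lp mu D 2%:E).
Local Notation nrm2 := (Lpnorm mu D 2%:E).
Local Notation dot2 := (L2dot mu D ip).

Lemma Lpnorm2_sqr (f : T -> U) : L2 f ->
  ((nrm2 f ^+ 2)%:E = \int[mu]_(x in D) (`|f x| ^+ 2)%:E)%E.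
Proof.
move=> fp; rewrite -powR_mulrn ?Lpnorm_ge0// -poweR_EFin.
rewrite /Lpnorm fineK; last by rewrite ge0_fin_numE ?Lnorm_ge0//; case: fp.
rewrite poweR_Lnorm ?pnatr_eq0// [RHS]integral_mkcond.
apply: eq_integral => x _ /=; rewrite !patchE; case: ifPn => _.
  by rewrite normr_id powR_mulrn.
by rewrite normr0 powR0 ?pnatr_eq0.
Qed.

Lemma measurable_ip (f g : T -> U) : strongly_measurable mu D f ->
  strongly_measurable mu D g -> measurable_fun D (fun x => ip (f x) (g x)).
Proof.
move=> mf mg; apply: (measurable_comp2 mD muD (F := fun v w => ip v w) _ mf mg).
exact: cvg_ip.
Qed.

Lemma integrable_ip (f g : T -> U) : L2 f -> L2 g ->
  mu.-integrable D (fun x => (ip (f x) (g x))%:E).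
Proof.
move=> fp gp; have [mf _] := fp; have [mg _] := gp.
have msq h : strongly_measurable mu D h -> measurable_fun D (fun x => (`|h x| ^+ 2)%:E).
  move=> mh; apply/measurable_EFinP.
  by apply: measurable_funX; exact: (measurable_norm mD muD mh).
apply/integrableP; split; first by apply/measurable_EFinP; exact: measurable_ip.
apply: (@le_lt_trans _ _ (\int[mu]_(x in D) ((`|f x| ^+ 2)%:E + (`|g x| ^+ 2)%:E))%E).
  apply: ge0_le_integral => //.
  - by apply/measurable_EFinP; apply: measurableT_comp => //; exact: measurable_ip.
  - by apply: emeasurable_funD; exact: msq.
  - move=> x Dx; rewrite abse_EFin -EFinD lee_fin.
    have := norm_ip_le (f x) (g x); have := sqr_ge0 `|f x|; have := sqr_ge0 `|g x|; lra.
rewrite ge0_integralD//; [|exact: msq|exact: msq].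
by rewrite -!Lpnorm2_sqr// -EFinD ltry.
Qed.

Lemma L2dotC (f g : T -> U) : dot2 f g = dot2 g f.
Proof. by apply: eq_Rintegral => x _; exact: ipC. Qed.

Lemma L2dot_sqr (f : T -> U) : L2 f -> dot2 f f = nrm2 f ^+ 2.
Proof.
move=> fp; rewrite /L2dot /Rintegral; under eq_integral do rewrite -hip.
by rewrite -Lpnorm2_sqr.
Qed.

Lemma L2dot_linear (a : R) (f g h : T -> U) : L2 f -> L2 g -> L2 h ->
  dot2 (a *: f + g) h = a * dot2 f h + dot2 g h.
Proof.
move=> fp gp hp; rewrite /L2dot.
under eq_Rintegral do rewrite ip_linear.
rewrite RintegralD//.
- by rewrite RintegralZl//; exact: integrable_ip.
- exact: (integrableZl mD a (integrable_ip fp hp)).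
- exact: integrable_ip.
Qed.

End InnerProduct.

(** * Integrals of power functions *)

Section PowerIntegral.
Context (R : realType).
Local Notation mu := (@lebesgue_measure R).

Lemma powR_continuous_pos (b x : R) : 0 < x ->
  {for x, continuous (fun y : R => y `^ b)}.
Proof.
move=> x0; apply: differentiable_continuous; apply/derivable1_diffP.
exact: (@ex_derive _ _ _ _ _ _ _ (is_derive1_powR b x0)).
Qed.

Lemma measurable_powR_EFin (b : R) (D : set R) :
  measurable_fun D (fun x : R => (x `^ b)%:E).
Proof. by apply/measurable_EFinP; apply: measurable_funTS; exact: measurable_powR. Qed.

Lemma integral_powR_pos_le (b c T : R) : -1 < b -> 0 < c ->
  (\int[mu]_(x in `[c, T]) (x `^ b)%:E <= ((b + 1)^-1 * T `^ (b + 1))%:E)%E.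
Proof.
move=> b1 c0; have b0 : 0 < b + 1 by rewrite -ltrBlDr sub0r.
have [Tc|cT] := leP T c.
  rewrite (_ : integral _ _ _ = 0%E) ?lee_fin ?mulr_ge0 ?invr_ge0 ?powR_ge0 ?ltW//.
  have [->|nTc] := eqVneq T c; first by rewrite set_itv1 integral_set1.
  by rewrite set_itv_ge ?integral_set0// bnd_simp -ltNge lt_neqAle nTc.
pose F (x : R) := (b + 1)^-1 *: x `^ (b + 1) : R.
have dF (x : R) : 0 < x -> is_derive x 1 F (x `^ b).
  move=> x0; have := is_deriveZ (b + 1)^-1 (is_derive1_powR (b + 1) x0).
  by rewrite addrK scalerA mulVf ?gt_eqF// scale1r.
have cF (x : R) : 0 < x -> {for x, continuous F}.
  move=> x0; apply: differentiable_continuous; apply/derivable1_diffP.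
  exact: (@ex_derive _ _ _ _ _ _ _ (dF x x0)).
have T0 : 0 < T by exact: lt_trans cT.
rewrite (@continuous_FTC2 _ (fun x => x `^ b) F)//.
- rewrite -EFinB lee_fin /F lerBlDr lerDl.
  by rewrite mulr_ge0 ?invr_ge0 ?powR_ge0 ?ltW.
- apply: continuous_in_subspaceT => x; rewrite inE/= in_itv/= => /andP[cx _].
  by apply: powR_continuous_pos; exact: lt_le_trans cx.
- split.
  + move=> x; rewrite in_itv/= => /andP[cx _].
    exact: (@ex_derive _ _ _ _ _ _ _ (dF x (lt_trans c0 cx))).
  + exact/cvg_at_right_filter/cF.
  + exact/cvg_at_left_filter/cF.
- move=> x; rewrite in_itv/= => /andP[cx _].
  by rewrite derive1E; apply: derive_val; apply: dF; exact: lt_trans cx.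
Qed.

Lemma integral_powR_lty (b a T : R) : -1 < b -> 0 <= a ->
  (\int[mu]_(x in `[a, T]) (x `^ b)%:E < +oo)%E.
Proof.
move=> b1 a0; pose F n : set R := `[a + n.+1%:R^-1, T]%classic.
have mF n : measurable (F n) by exact: measurable_itv.
have FU : \bigcup_n F n = `]a, T]%classic.
  apply/seteqP; split => [x [n _]|x].
    rewrite /F/= !in_itv/= => /andP[ax ->].
    by rewrite andbT; apply: lt_le_trans ax; rewrite ltrDl.
  rewrite /= in_itv/= => /andP[ax xT].
  exists (Num.truncn (x - a)^-1) => //=; rewrite /F/= in_itv/= xT andbT.
  rewrite -lerBrDl -[leRHS]invrK lef_pV2 ?posrE ?invr_gt0 ?subr_gt0//.
  exact/ltW/truncnS_gt.
have ndF : {homo F : n m / (n <= m)%N >-> (n <= m)%O}.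
  move=> n m nm; apply/subsetPset => x; rewrite /F/= !in_itv/= => /andP[ax ->].
  rewrite andbT (le_trans _ ax)// lerD2l lef_pV2 ?posrE//.
  by rewrite ler_nat ltnS.
have -> : (\int[mu]_(x in `[a, T]) (x `^ b)%:E =
    \int[mu]_(x in `]a, T]) (x `^ b)%:E)%E.
  by rewrite integral_itv_obnd_cbnd//; exact: measurable_powR_EFin.
rewrite -FU.
have cvgF : (\int[mu]_(x in F n) (x `^ b)%:E)%E @[n --> \oo] -->
    (\int[mu]_(x in \bigcup_n F n) (x `^ b)%:E)%E.
  apply: ge0_nondecreasing_set_cvg_integral => //.
    by move=> n; exact: measurable_powR_EFin.
  by move=> n x _; rewrite lee_fin powR_ge0.
apply: (@le_lt_trans _ _ ((b + 1)^-1 * T `^ (b + 1))%:E); last exact: ltry.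
apply: (cvge_to_le cvgF).
apply: nearW => n; apply: integral_powR_pos_le => //.
by rewrite ltr_wpDl.
Qed.

End PowerIntegral.

(** * The evolution of source terms *)

Section WeightedOperator.
Context (R : realType) (Z : completeNormedModType R).
Variables (alpha zeta t2 : R) (Psi : R -> R -> Z -> Z) (M : R).
Local Notation mu := (@lebesgue_measure R).
Local Notation I := (`[zeta, t2]%classic).
Hypotheses (halpha : 0 < alpha <= 1) (zeta0 : 0 <= zeta) (M0 : 0 <= M).
Hypothesis Psi_linear : forall s, I s -> linear (Psi t2 s).
Hypothesis Psi_bounded : forall s z, I s -> `|Psi t2 s z| <= M * `|z|.
Hypothesis Psi_continuous : forall z (r : nat -> R) s,
  (forall n, I (r n)) -> I s -> r @ \oo --> s ->
  (fun n => Psi t2 (r n) z) @ \oo --> Psi t2 s z.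

Lemma measurable_segment : measurable (I : set (measurableTypeR R)).
Proof. exact: measurable_itv. Qed.

Lemma segment_lty : (mu I < +oo)%E.
Proof.
by rewrite lebesgue_measure_itv; case: ifPn => //= _; rewrite -EFinB ltry.
Qed.

Let mI := measurable_segment.
Let muI := segment_lty.

Lemma step_truncn (y : R -> R) (N : nat) : measurable_fun (I : set (measurableTypeR R)) y ->
  (forall x, I x -> 0 <= y x < N%:R) -> step (I : set (measurableTypeR R)) (fun x => Num.truncn (y x)).
Proof.
move=> my yN; split.
  apply: (sub_finite_set _ (finite_II N)) => _ [x Ix <-] /=.
  have /andP[y0 yN'] := yN x Ix; have /andP[ty _] := truncn_itv y0.
  by rewrite -(ltr_nat R); exact: le_lt_trans yN'.
move=> k; rewrite (_ : _ `&` _ = I `&` y @^-1` `[k%:R, k.+1%:R[).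
  by apply: my => //; exact: measurable_itv.
apply/seteqP; split => x [Ix /= xk]; split => //=.
  have /andP[y0 _] := yN x Ix; have := truncn_itv y0.
  by rewrite xk in_itv.
by rewrite in_itv/= in xk; exact: truncn_def.
Qed.

(** Discretization from the left, exact at the left endpoint: the weight may be
    discontinuous there, when [zeta = 0]. *)
Definition grid (n : nat) (s : R) : R :=
  zeta + (Num.truncn ((s - zeta) * n.+1%:R))%:R / n.+1%:R.

Lemma grid_itv n s : I s -> zeta <= grid n s <= s.
Proof.
rewrite /= in_itv/= => /andP[zs _].
have y0 : 0 <= (s - zeta) * n.+1%:R by rewrite mulr_ge0// subr_ge0.
rewrite /grid lerDl divr_ge0//= -lerBrDl ler_pdivrMr//.
by have /andP[] := truncn_itv y0.
Qed.

Lemma grid_in n s : I s -> I (grid n s).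
Proof.
move=> Is; have /andP[zg gs] := grid_itv n Is.
by move: Is; rewrite /= !in_itv/= zg => /andP[_]; exact: le_trans.
Qed.

Lemma cvg_grid s : I s -> grid ^~ s @ \oo --> s.
Proof.
move=> Is; apply/cvgrPdist_lt => e e0.
have h := @near_infty_natSinv_lt R (PosNum e0).
apply: filterS h => n /= ne; apply: le_lt_trans ne.
have /andP[_ gs] := grid_itv n Is; rewrite ger0_norm ?subr_ge0//.
have zs : zeta <= s by move: Is; rewrite /= in_itv/= => /andP[].
have y0 : 0 <= (s - zeta) * n.+1%:R by rewrite mulr_ge0// subr_ge0.
rewrite /grid opprD addrA lerBlDr -[X in _ <= X + _]mul1r -mulrDl ler_pdivlMr//.
by rewrite nat1r; have /andP[_ /ltW] := truncn_itv y0.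
Qed.

Lemma step_grid n : step (I : set (measurableTypeR R)) (grid n).
Proof.
pose G (k : nat) := zeta + k%:R / n.+1%:R.
have : step (I : set (measurableTypeR R)) (fun s : R => Num.truncn ((s - zeta) * n.+1%:R)); last first.
  exact: step_comp G _.
apply: (@step_truncn _ (Num.truncn ((t2 - zeta) * n.+1%:R)).+1).
  by apply: measurable_funM => //; exact: measurable_funB.
move=> x; rewrite /= in_itv/= => /andP[zx xt].
rewrite mulr_ge0 ?subr_ge0//=; apply: le_lt_trans (truncnS_gt _).
by rewrite ler_wpM2r// lerB.
Qed.

Lemma cvg_weight s : I s ->
  (fun n => grid n s `^ (alpha - 1)) @ \oo --> s `^ (alpha - 1).
Proof.
move=> Is; have [->|sz] := eqVneq s zeta.
  apply: cvg_near_cst; apply: nearW => n.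
  by rewrite /grid subrr mul0r truncn0 mul0r addr0.
have s0 : 0 < s.
  move: Is; rewrite /= in_itv/= => /andP[zs _].
  by apply: le_lt_trans zeta0 _; rewrite lt_neqAle eq_sym sz.
apply: (@continuous_cvg _ _ _ _ _ _ (fun x : R => x `^ (alpha - 1))).
  exact: powR_continuous_pos.
exact: cvg_grid.
Qed.

(** The integrand is the limit of its values at discretized times, taken along
    simple approximations of [h]. *)
Lemma weighted_strongly_measurable (h : R -> Z) :
  strongly_measurable mu I h ->
  strongly_measurable mu I (weighted alpha Psi t2 h).
Proof.
move=> [u [su uh]].
pose F (w : R * Z) := w.1 `^ (alpha - 1) *: Psi t2 w.1 w.2.
exists (fun n x => F (grid n x, u n x)); split => [n|s Is].
  apply/(simple_mapP mI muI).
  apply: (@step_comp _ _ _ _ _ F (fun x => (grid n x, u n x))).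
  by apply: step_pair; [exact: step_grid|exact/(simple_mapP mI muI)].
apply: cvgZ; first exact: cvg_weight.
have hPsi : (fun n => Psi t2 (grid n s) (h s)) @ \oo --> Psi t2 s (h s).
  by apply: Psi_continuous => //; [move=> n; exact: grid_in|exact: cvg_grid].
have -> : (fun n => Psi t2 (grid n s) (u n s)) =
    (fun n => Psi t2 (grid n s) (u n s - h s) + Psi t2 (grid n s) (h s)).
  apply/funext => n; rewrite -[u n s - h s](_ : -1 *: h s + u n s = _); last first.
    by rewrite scaleN1r addrC.
  by rewrite (Psi_linear (grid_in n Is)) scaleN1r addrAC addNr add0r.
rewrite -[X in _ --> X]add0r; apply: cvgD => //.
have uh0 : (fun n => M * `|h s - u n s|) @ \oo --> (0 : R).
  rewrite -(mulr0 M); apply: cvgMr; rewrite -(normr0 Z) -(subrr (h s)).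
  by apply: cvg_norm; apply: cvgB; [exact: cvg_cst|exact: uh].
apply/cvgr0Pnorm_lt => e e0; move/cvgr0Pnorm_lt: uh0 => /(_ e e0).
apply: filterS => n; apply: le_lt_trans.
rewrite ger0_norm ?mulr_ge0// distrC; apply: Psi_bounded; exact: grid_in.
Qed.

Lemma weighted_linear (a : R) (f g : R -> Z) s : I s ->
  weighted alpha Psi t2 (a *: f + g) s =
    a *: weighted alpha Psi t2 f s + weighted alpha Psi t2 g s.
Proof.
move=> Is; rewrite /weighted.
have -> : (a *: f + g) s = a *: f s + g s by [].
by rewrite (Psi_linear Is) scalerDr !scalerA mulrC.
Qed.

Lemma has_integral_weighted_linear (a : R) (f g : R -> Z) v w :
  has_bochner_integral mu I (weighted alpha Psi t2 f) v ->
  has_bochner_integral mu I (weighted alpha Psi t2 g) w ->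
  has_bochner_integral mu I (weighted alpha Psi t2 (a *: f + g)) (a *: v + w).
Proof.
move=> fv gw; have := has_bochner_integral_linear mI muI a fv gw.
apply: eq_has_bochner_integral => s Is; exact/esym/weighted_linear.
Qed.

Section SourceTerm.
Variable xi : R.
Hypothesis hxi : 0 <= xi < alpha.
(* [+oo] when [xi = 0] *)
Let p : \bar R := ((xi%:E)^-1)%E.
Let q : R := (1 - xi)^-1.

Lemma source_exponents : [/\ (1 <= p)%E, 0 < q & (p^-1 + (q^-1)%:E = 1)%E].
Proof.
have xi1 : xi < 1 by have := halpha; have := hxi; lra.
have xi0 : 0 <= xi by case/andP: hxi.
split.
- rewrite /p; have [->|x0] := eqVneq xi 0; first by rewrite inve0 leey.
  rewrite inver (negbTE x0) lee_fin invf_ge1 ?ltW// lt0r x0; exact: xi0.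
- by rewrite invr_gt0 subr_gt0.
- by rewrite /p inveK /q invrK -EFinD addrC subrK.
Qed.

(** The weight has a finite norm for the exponent conjugate to [p].  When the
    segment starts at 0, where [s^(alpha - 1)] is singular, this is due to
    [xi < alpha]. *)
Lemma weight_Lq :
  ('N[mu]_(q%:E)[EFin \o ((fun s : R => s `^ (alpha - 1))%R \_ I)] < +oo)%E.
Proof.
have [_ q0 _] := source_exponents.
rewrite Lnorm_powRE poweR_lty//.
have -> : (\int[mu]_x (`|((fun s : R => s `^ (alpha - 1)) \_ I) x| `^ q)%:E =
    \int[mu]_(x in I) (x `^ ((alpha - 1) * q))%:E)%E.
  rewrite [RHS]integral_mkcond; apply: eq_integral => x _.
  rewrite !patchE; case: ifPn => _; first by rewrite ger0_norm ?powR_ge0// powRrM.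
  by rewrite normr0 powR0// gt_eqF.
apply: integral_powR_lty => //.
have xi1 : xi < 1 by have := halpha; have := hxi; lra.
rewrite /q ltr_pdivlMr ?subr_gt0//; have := hxi; lra.
Qed.

Lemma weighted_norm_integral : exists2 C : R, 0 <= C &
  forall h : R -> Z, Lp mu I p h ->
    (\int[mu]_(s in I) `|weighted alpha Psi t2 h s|%:E <=
       (C * Lpnorm mu I p h)%:E)%E.
Proof.
have [p1 q0 pq] := source_exponents.
pose N := fine 'N[mu]_(q%:E)[EFin \o ((fun s : R => s `^ (alpha - 1))%R \_ I)]%E.
exists (M * N); first by rewrite mulr_ge0// fine_ge0// Lnorm_ge0.
move=> h hp; have [mh _] := hp.
have mw : measurable_fun (I : set (measurableTypeR R)) (fun s : R => s `^ (alpha - 1)).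
  by apply: measurable_funTS; exact: measurable_powR.
have mwh : measurable_fun (I : set (measurableTypeR R))
    (fun s => (`|s `^ (alpha - 1)| * `|h s|)%:E).
  apply/measurable_EFinP; apply: measurable_funM.
    exact: measurableT_comp.
  exact: (measurable_norm mI muI mh).
have := Lp_hoelder mI muI p1 q0 pq mw weight_Lq hp.
move=> hoelder_bound; rewrite -mulrA EFinM.
apply: le_trans (lee_wpmul2l _ hoelder_bound); last by rewrite lee_fin.
rewrite -ge0_integralZl//.
apply: ge0_le_integral => //.
- exact: (measurable_norm_EFin mI muI (weighted_strongly_measurable mh)).
- exact: measurable_funeM.
- move=> s Is; rewrite -EFinM lee_fin normrZ mulrCA.
  by rewrite ler_wpM2l// Psi_bounded.
Qed.

Lemma weighted_integrable (h : R -> Z) : Lp mu I p h ->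
  bochner_integrable mu I (weighted alpha Psi t2 h).
Proof.
move=> hp; have [C C0 Ch] := weighted_norm_integral; have [mh _] := hp.
apply: (bochner_integrable_of_norm mI muI (weighted_strongly_measurable mh)).
exact: le_lt_trans (Ch h hp) (ltry _).
Qed.

Lemma Nop_bounded : zeta <= t2 -> exists2 C : R, 0 <= C &
  forall z0 h, Lp mu I p h ->
    `|Nop alpha zeta t2 Psi z0 h| <= C * (`|z0| + Lpnorm mu I p h).
Proof.
move=> zt2; have [C C0 Ch] := weighted_norm_integral.
exists (M + C); first by rewrite addr_ge0.
move=> z0 h hp; apply: le_trans (ler_normD _ _) _.
have Psi_z0 : `|Psi t2 zeta z0| <= M * `|z0|.
  by apply: Psi_bounded; rewrite /= in_itv/= lexx.
have source : `|bochner mu I (weighted alpha Psi t2 h)| <= C * Lpnorm mu I p h.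
  rewrite -lee_fin; apply: le_trans (Ch h hp).
  exact: (bochner_norm mI muI (bochner_integral_correct mI muI (weighted_integrable hp))).
apply: le_trans (lerD Psi_z0 source) _; rewrite mulrDl !mulrDr.
by apply: lerD; [rewrite lerDl|rewrite lerDr]; rewrite mulr_ge0// Lpnorm_ge0.
Qed.

Lemma Nop_linear (a : R) z0 h z0' h' : zeta <= t2 ->
  Lp mu I p h -> Lp mu I p h' ->
  Nop alpha zeta t2 Psi (a *: z0 + z0') (a *: h + h') =
    a *: Nop alpha zeta t2 Psi z0 h + Nop alpha zeta t2 Psi z0' h'.
Proof.
move=> zt2 hp hp'.
have hi := bochner_integral_correct mI muI (weighted_integrable hp).
have hi' := bochner_integral_correct mI muI (weighted_integrable hp').
rewrite /Nop (bochnerE mI muI (has_integral_weighted_linear a hi hi')).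
have Izeta : I zeta by rewrite /= in_itv/= lexx.
by rewrite (Psi_linear Izeta) scalerDr addrACA.
Qed.

End SourceTerm.
End WeightedOperator.

(** * Least norm solutions of linear equations *)

Lemma scale_half_double (R : realType) (V : lmodType R) (z : V) :
  2^-1 *: (z + z) = z.
Proof. by rewrite -mulr2n -[z *+ 2]scaler_nat scalerA mulVf// scale1r. Qed.

Section Pseudoinverse.
(* [dot] is a semi-inner product on [P] with seminorm [nu]. *)
Context (R : realType) (E : lmodType R) (P : set E) (nu : E -> R)
  (dot : E -> E -> R) (Z : normedModType R) (L : E -> Z) (K : R).
Hypotheses (snu : seminorm_on P nu) (cplt : rapidly_complete P nu)
  (dotC : forall x y, dot x y = dot y x)
  (dot_linear : forall (a : R) x y z, P x -> P y -> P z ->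
     dot (a *: x + y) z = a * dot x z + dot y z)
  (dot_sqr : forall x, P x -> dot x x = nu x ^+ 2)
  (L_linear : forall (a : R) x y, P x -> P y -> L (a *: x + y) = a *: L x + L y)
  (L_bounded : forall x, P x -> `|L x| <= K * nu x).

Let PD x y : P x -> P y -> P (x + y). Proof. exact: (subspaceD snu). Qed.
Let PZ (a : R) x : P x -> P (a *: x). Proof. exact: (subspaceZ snu). Qed.
Let PB x y : P x -> P y -> P (x - y). Proof. exact: (subspaceB snu). Qed.

Lemma seminorm_addZ (a : R) x y : P x -> P y ->
  nu (a *: x + y) ^+ 2 = a ^+ 2 * nu x ^+ 2 + 2 * a * dot x y + nu y ^+ 2.
Proof.
move=> Px Py; have Pxy : P (a *: x + y) by exact: (sn_linear snu).
rewrite -!dot_sqr// dot_linear// [dot x (_ + _)]dotC [dot y (_ + _)]dotC.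
rewrite !dot_linear// [dot y x]dotC; ring.
Qed.

Lemma seminorm_parallelogram x y : P x -> P y ->
  nu (x + y) ^+ 2 + nu (x - y) ^+ 2 = 2 * (nu x ^+ 2 + nu y ^+ 2).
Proof.
move=> Px Py; rewrite -[x + y](_ : 1 *: x + y = _); last by rewrite scale1r.
rewrite -[x - y](_ : -1 *: y + x = _); last by rewrite scaleN1r addrC.
by rewrite !seminorm_addZ// [dot y x]dotC; ring.
Qed.

Lemma L_sub x y : P x -> P y -> L (x - y) = L x - L y.
Proof.
move=> Px Py; rewrite -[x - y](_ : -1 *: y + x = _); last by rewrite scaleN1r addrC.
by rewrite L_linear// scaleN1r addrC.
Qed.

Lemma L_midpoint x y : P x -> P y -> L (2^-1 *: (x + y)) = 2^-1 *: (L x + L y).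
Proof.
move=> Px Py; have P0 := sn_0 snu.
have L0 : L 0 = 0 by rewrite -(subrr 0) L_sub// subrr.
rewrite !scalerDr L_linear//; last exact: PZ.
by rewrite -[2^-1 *: y]addr0 L_linear// L0 addr0.
Qed.

(** The kernel of [L] in [P] and its orthogonal complement. *)
Definition ker_on : set E := [set u | P u /\ L u = 0].

Definition perp : set E := [set u | P u /\ forall v, ker_on v -> dot u v = 0].

Lemma perp_linear (a : R) u v : perp u -> perp v -> perp (a *: u + v).
Proof.
move=> [Pu pu] [Pv pv]; split; first exact: (sn_linear snu).
by move=> w kw; have [Pw _] := kw; rewrite dot_linear// pu// pv// mulr0 addr0.
Qed.

Lemma ker_sub u v : P u -> P v -> L u = L v -> ker_on (u - v).
Proof. by move=> Pu Pv Luv; split; [exact: PB|rewrite L_sub// Luv subrr]. Qed.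

Lemma perp_unique u v : perp u -> perp v -> L u = L v -> nu (u - v) = 0.
Proof.
move=> [Pu pu] [Pv pv] Luv; have kw := ker_sub Pu Pv Luv; have [Pw _] := kw.
apply/eqP; rewrite -sqrf_eq0 -dot_sqr//.
rewrite -[X in dot X](_ : -1 *: v + u = _); last by rewrite scaleN1r addrC.
by rewrite dot_linear// pu// pv// mulr0 addr0.
Qed.

(** An element orthogonal to the kernel is the least norm solution of its
    equation. *)
Lemma perp_least u v : perp u -> P v -> L v = L u -> nu u <= nu v.
Proof.
move=> [Pu pu] Pv Luv; have kw := ker_sub Pv Pu Luv; have [Pw _] := kw.
rewrite -ler_sqr ?nnegrE ?(sn_ge0 snu)//.
rewrite -[X in _ <= nu X ^+ 2](_ : 1 *: (v - u) + u = _); last by rewrite scale1r subrK.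
rewrite seminorm_addZ// dotC pu// mulr0 addr0 lerDr.
by rewrite mulr_ge0 ?sqr_ge0.
Qed.

Lemma L_limit (v : E) (u : nat -> E) (y : Z) (k : R) : P v -> (forall n, P (u n)) ->
  (forall n, nu (v - u n) <= 2 * 2^-1 ^+ n) ->
  (forall n, `|L (u n) - y| <= k * 2^-1 ^+ n) -> L v = y.
Proof.
move=> Pv Pu vu uy; apply/eqP; rewrite -subr_eq0 -normr_le0.
apply: (@le_of_exp_half _ _ _ (2 * `|K| + k)) => n; rewrite add0r mulrDl.
rewrite -[L v](subrK (L (u n))) -addrA.
apply: le_trans (ler_normD _ _) _; apply: lerD => //.
rewrite -L_sub//; apply: le_trans (L_bounded (PB Pv (Pu n))) _.
apply: (@le_trans _ _ (`|K| * nu (v - u n))).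
  by rewrite ler_wpM2r ?ler_norm// (sn_ge0 snu)//; exact: PB.
by rewrite [2 * _]mulrC -mulrA ler_wpM2l.
Qed.

(** Orthogonal projection: a least norm solution [v] of [L v = L x] exists by
    completeness, and minimality along the lines [v + t w], [w] in the kernel,
    makes it orthogonal to the kernel. *)
Lemma perp_exists x : P x -> exists2 u, perp u & L u = L x.
Proof.
move=> Px; pose C (n : nat) := [set w | P w /\ L w = L x].
have [| | | | |v [u [Pv Cu vu vmin]]] := @least_norm_limit _ _ _ _ snu C (nu x) cplt.
- exact: seminorm_parallelogram.
- by move=> m n _ w.
- by move=> n w [].
- move=> n w w' [Pw Lw] [Pw' Lw']; split; first exact/PZ/PD.
  by rewrite L_midpoint// Lw Lw' scale_half_double.
- by move=> n; exists x.
have Lv : L v = L x.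
  apply: (@L_limit v u _ 0 Pv) => // n; first by have [] := Cu n.
  by have [_ ->] := Cu n; rewrite subrr normr0 mul0r.
exists v => //; split => // w [Pw Lw].
have quad t : 0 <= t ^+ 2 * nu w ^+ 2 + 2 * t * dot w v.
  have : nu v ^+ 2 <= nu (t *: w + v) ^+ 2.
    rewrite ler_sqr ?nnegrE ?(sn_ge0 snu)//; last exact: (sn_linear snu).
    apply: vmin => n; exists (t *: w + v) => //; split; first exact: (sn_linear snu).
    by rewrite L_linear// Lw scaler0 add0r.
  by rewrite seminorm_addZ// lerDr.
rewrite dotC; set a := nu w ^+ 2 in quad; set b := dot w v in quad *.
have a0 : 0 <= a by exact: sqr_ge0.
(* a may vanish: t minimizes the quadratic with a + 1 in place of a *)
have a1 : 0 < a + 1 by rewrite ltr_wpDl.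
have := quad (- b / (a + 1)).
have -> : (- b / (a + 1)) ^+ 2 * a + 2 * (- b / (a + 1)) * b =
    - (b ^+ 2 * ((a + 2) / (a + 1) ^+ 2)).
  by field; rewrite gt_eqF.
rewrite oppr_ge0 pmulr_lle0; last by rewrite divr_gt0 ?exprn_gt0// ltr_wpDl.
by rewrite -[_ <= 0]/(b ^+ 2 <= 0) => b2; apply/eqP; rewrite -sqrf_eq0 eq_le b2 sqr_ge0.
Qed.

(** The norm of the least norm solution is lower semicontinuous in the data: it
    is at most [c] as soon as elements of norm at most [c] solve the equation
    approximately. *)
Lemma perp_norm_le u c k : perp u ->
  (forall n, exists v, [/\ P v, nu v <= c & `|L v - L u| <= k * 2^-1 ^+ n]) ->
  nu u <= c.
Proof.
move=> pu approx; have [Pu _] := pu.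
have k0 : 0 <= k.
  by have [v [_ _]] := approx 0%N; rewrite expr0 mulr1; exact: le_trans.
pose C (n : nat) := [set w | [/\ P w, nu w <= c & `|L w - L u| <= k * 2^-1 ^+ n]].
have [| | | | |v [w [Pv Cw vw vmin]]] := @least_norm_limit _ _ _ _ snu C c cplt.
- exact: seminorm_parallelogram.
- move=> m n mn x [Px xc Lx]; split => //; apply: le_trans Lx _.
  by rewrite ler_wpM2l// ler_wiXn2l// invf_le1// ler1n.
- by move=> n x [].
- move=> n x y [Px xc Lx] [Py yc Ly]; split; first exact/PZ/PD.
    rewrite (sn_Z snu); last exact: PD.
    rewrite ger0_norm// mulrC ler_pdivrMr// mulr_natr mulr2n.
    by apply: le_trans (sn_D snu Px Py) _; exact: lerD.
  have -> : L (2^-1 *: (x + y)) - L u = 2^-1 *: ((L x - L u) + (L y - L u)).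
    by rewrite L_midpoint// addrACA -opprD scalerBr scale_half_double.
  rewrite normrZ ger0_norm// mulrC ler_pdivrMr// mulr_natr mulr2n.
  by apply: le_trans (ler_normD _ _) _; exact: lerD.
- by move=> n; have [x [Px xc Lx]] := approx n; exists x.
have Lv : L v = L u.
  by apply: (@L_limit v w _ k Pv) => // n; have [] := Cw n.
apply: le_trans (perp_least pu Pv Lv) _; apply: vmin => n.
by have [x [Px xc Lx]] := approx n; exists x.
Qed.

Section Composition.
Variables (F : lmodType R) (Q : set F) (nuF : F -> R) (N : F -> Z) (KN : R)
  (H : F -> E).
Hypotheses (snuF : seminorm_on Q nuF) (cpltF : rapidly_complete Q nuF)
  (N_linear : forall (a : R) x y, Q x -> Q y -> N (a *: x + y) = a *: N x + N y)
  (N_bounded : forall x, Q x -> `|N x| <= KN * nuF x)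
  (H_perp : forall x, Q x -> perp (H x)) (LH : forall x, Q x -> L (H x) = N x).

Lemma pseudoinverse_linear (a : R) x y : Q x -> Q y ->
  nu (H (a *: x + y) - (a *: H x + H y)) = 0.
Proof.
move=> Qx Qy; have Qxy : Q (a *: x + y) by exact: (sn_linear snuF).
apply: perp_unique; [exact: H_perp|by apply: perp_linear; exact: H_perp|].
have [[PHx _] [PHy _]] := (H_perp Qx, H_perp Qy).
by rewrite LH// N_linear// L_linear// !LH.
Qed.

Lemma nu_sub0 u v : P u -> P v -> nu (u - v) = 0 -> nu u = nu v.
Proof.
move=> Pu Pv uv0; apply/eqP; rewrite eq_le; apply/andP; split.
  by rewrite -{1}[u](subrK v) -[leRHS]add0r -uv0 (sn_D snu)//; exact: PB.
rewrite -{1}[v](subrK u) -[leRHS]add0r -uv0 (sn_subC snu Pu Pv) (sn_D snu)//.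
exact: PB.
Qed.

Let PH x : Q x -> P (H x). Proof. by move=> /H_perp[]. Qed.

(** [H] is a linear selection, up to [nu]-null elements, of least norm solutions
    of [L (H x) = N x]; it is bounded although [L] need not have closed range. *)
Theorem pseudoinverse_bounded :
  exists C : R, forall x, Q x -> nu (H x) <= C * nuF x.
Proof.
have nuH (a : R) x y : Q x -> Q y -> nu (H (a *: x + y)) = nu (a *: H x + H y).
  move=> Qx Qy; apply: nu_sub0; last exact: pseudoinverse_linear.
    by apply: PH; exact: (sn_linear snuF).
  by apply: (sn_linear snu); exact: PH.
have nuH0 : nu (H 0) = 0.
  have Q0 := sn_0 snuF.
  have := nuH (-1) 0 0 Q0 Q0; rewrite scaler0 addr0 scaleN1r addNr => ->.
  by rewrite -(scale0r 0) (sn_Z snu) ?normr0 ?mul0r//; exact: sn_0 snu.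
apply: (lsc_seminorm_bounded snuF cpltF).
- by move=> x Qx; apply: (sn_ge0 snu); exact: PH.
- move=> a x Qx; have Q0 := sn_0 snuF.
  rewrite -[a *: x]addr0 nuH//; rewrite -(sn_Z snu); last exact: PH.
  have PaH : P (a *: H x) by apply: PZ; exact: PH.
  apply: nu_sub0 => //; first by apply: PD => //; exact: PH.
  by rewrite addrAC subrr add0r.
- move=> x y Qx Qy; rewrite -[x]scale1r nuH// !scale1r.
  by apply: (sn_D snu); exact: PH.
- move=> x c Qx cx; apply: contrapT => nor.
  suff : nu (H x) <= c by rewrite leNgt cx.
  apply: (@perp_norm_le _ _ `|KN| (H_perp Qx)) => n.
  have [y [Qy yx yc]] : exists y, [/\ Q y, nuF (y - x) <= 2^-1 ^+ n & nu (H y) <= c].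
    apply: contrapT => noy; apply: nor; exists (2^-1 ^+ n); first by rewrite exprn_gt0.
    move=> y Qy yx; rewrite ltNge; apply/negP => yc; apply: noy; by exists y.
  exists (H y); split => //; first exact: PH.
  rewrite !LH//; have Qyx : Q (y - x) by exact: (subspaceB snuF).
  have -> : N y - N x = N (y - x).
    rewrite -[y - x](_ : -1 *: x + y = _); last by rewrite scaleN1r addrC.
    by rewrite N_linear// scaleN1r addrC.
  apply: le_trans (N_bounded Qyx) _.
  apply: (@le_trans _ _ (`|KN| * nuF (y - x))); last by rewrite ler_wpM2l.
  by rewrite ler_wpM2r ?ler_norm// (sn_ge0 snuF).
Qed.

End Composition.
End Pseudoinverse.

(** * Null controllability *)

(** Joint continuity of the evolution operator, read along sequences of initial
    times with the final time fixed. *)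
Lemma evolution_operator_cvg (R : realType) (Z : normedModType R)
    (alpha t1 t2 : R) (DA : R -> set Z) (A : R -> Z -> Z) (Psi : R -> R -> Z -> Z)
    (z : Z) (r : nat -> R) (s : R) :
  evolution_operator alpha t1 t2 DA A Psi ->
  (forall n, t1 <= r n <= t2) -> t1 <= s <= t2 -> r @ \oo --> s ->
  (fun n => Psi t2 (r n) z) @ \oo --> Psi t2 s z.
Proof.
move=> ev rI /andP[s1 s2] rs.
have /subspace_continuousP/(_ (t2, s)) c := @ev_continuous _ _ _ _ _ _ _ _ ev z.
have St : [set p : R * R | [/\ t1 <= p.2, p.2 <= p.1 & p.1 <= t2]] (t2, s) by [].
apply: (cvg_comp (fun n => (t2, r n)) (fun p : R * R => Psi p.1 p.2 z) _ (c St)).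
move=> B /= [[X Y] /= [nX nY] XYB].
have : \forall n \near \oo, Y (r n) by exact: rs nY.
apply: filterS => n Yn; apply: (XYB (t2, r n)).
  by split => //=; exact: nbhs_singleton.
by have /andP[] := rI n.
Qed.

Theorem lemma3p7 (R : realType) (Z U : completeNormedModType R)
  (ipZ : {dot Z for idfun}) (ipU : {dot U for idfun})
  (hipZ : inner_product_norm ipZ) (hipU : inner_product_norm ipU)
  (alpha t0 tf zeta omega delta xi : R)
  (halpha : 0 < alpha <= 1) (ht : 0 <= t0 < tf)
  (homega : 0 < omega < pi / 2) (hdelta : 0 < delta <= 1)
  (DA : R -> set Z) (A : R -> Z -> Z)
  (hA : sectorial_family alpha t0 tf omega delta DA A)
  (Psi : R -> R -> Z -> Z) (B : {linear U -> Z}) (hB : bounded_operator B) :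
  let t1 := (alpha * t0) `^ alpha^-1 in
  let t2 := (alpha * tf) `^ alpha^-1 in
  let mu := @lebesgue_measure R in
  let I := `[zeta, t2]%classic in
  let p := ((xi%:E)^-1)%E in
  let L := Lop alpha zeta t2 Psi B in
  let N := Nop alpha zeta t2 Psi in
  let kerLperp := Lker_perp alpha zeta t2 Psi B ipU in
  let H := Hop alpha zeta t2 Psi B ipU in
  t0 <= zeta <= tf -> t1 <= zeta <= t2 ->
  evolution_operator alpha t1 t2 DA A Psi ->
  0 <= xi < Num.min alpha delta ->
  Lop_bounded alpha zeta t2 Psi B ->
  exactly_null_controllable alpha zeta t2 Psi B p ->
  (* H = (L restricted to (ker L)^perp)^-1 o N is well defined *)
  [/\ forall u v, kerLperp u -> kerLperp v -> L u = L v -> ae_equal mu I u v,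
      forall z0 h, Lp mu I p h -> kerLperp (H z0 h) /\ L (H z0 h) = N z0 h,
  (* H is linear and bounded *)
      forall (a : R) z0 h z0' h', Lp mu I p h -> Lp mu I p h' ->
        ae_equal mu I (H (a *: z0 + z0') (a *: h + h'))
                      (a *: H z0 h + H z0' h'),
      exists C : R, forall z0 h, Lp mu I p h ->
        Lpnorm mu I 2%:E (H z0 h) <= C * (`|z0| + Lpnorm mu I p h) &
  (* the control - H (z0, h) steers the system from z0 to 0 *)
      forall z0 h, Lp mu I p h ->
        steers_to_0 alpha zeta t2 Psi B z0 (- H z0 h) h].
Proof.
move=> t1 t2 mu I p L N kerLperp H _ /andP[t1z zt2] ev hxi [Lint [CL LB]] Hnull.
have zeta0 : 0 <= zeta by apply: le_trans t1z; exact: powR_ge0.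
have hxi' : 0 <= xi < alpha by move: hxi; rewrite lt_min => /andP[-> /andP[->]].
have It s : I s -> t1 <= s /\ s <= t2.
  by rewrite /I/= in_itv/= => /andP[zs ->]; split => //; exact: le_trans zs.
have Psi_linear s : I s -> linear (Psi t2 s).
  by move=> /It[t1s st2]; exact: (ev_linear ev).
have [M PsiM] := ev_bounded ev.
have Psi_bounded s z : I s -> `|Psi t2 s z| <= `|M| * `|z|.
  move=> /It[t1s st2]; apply: le_trans (PsiM s t2 t1s st2 (lexx _) z) _.
  by rewrite ler_wpM2r// ler_norm.
have Psi_continuous z (r : nat -> R) s : (forall n, I (r n)) -> I s ->
    r @ \oo --> s -> (fun n => Psi t2 (r n) z) @ \oo --> Psi t2 s z.
  move=> Ir Is rs.
  have rI n : t1 <= r n <= t2 by have [-> ->] := It _ (Ir n).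
  have sI : t1 <= s <= t2 by have [-> ->] := It _ Is.
  exact: (evolution_operator_cvg ev rI sI rs).
have mI := @measurable_segment R zeta t2; have muI := @segment_lty R zeta t2.
have [p1 q0 pq] := source_exponents halpha hxi'.
have one2 : (1 <= 2%:E :> \bar R)%E by rewrite lee_fin ler1n.
have two0 : (0 : R) < 2 by [].
have two2 : ((2%:E)^-1 + (2^-1)%:E = 1 :> \bar R)%E.
  by rewrite inver pnatr_eq0/= -EFinD; congr EFin; field.
have s2 := Lp_seminorm mI muI one2 U.
have c2 : rapidly_complete (Lp mu I 2%:E : set (R -> U)) (Lpnorm mu I 2%:E).
  by move=> u uP uc; exact: (Lp_complete mI muI one2 two0 two2 uP uc).
have dot_sqr u : Lp mu I 2%:E u -> L2dot mu I ipU u u = Lpnorm mu I 2%:E u ^+ 2.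
  exact: L2dot_sqr.
have dot_linear (a : R) (u v w : R -> U) : Lp mu I 2%:E u -> Lp mu I 2%:E v ->
    Lp mu I 2%:E w -> L2dot mu I ipU (a *: u + v) w =
    a * L2dot mu I ipU u w + L2dot mu I ipU v w.
  exact: L2dot_linear.
have L_linear (a : R) (u v : R -> U) : Lp mu I 2%:E u -> Lp mu I 2%:E v ->
    L (a *: u + v) = a *: L u + L v.
  move=> u2 v2; have iu := bochner_integral_correct mI muI (Lint u u2).
  have iv := bochner_integral_correct mI muI (Lint v v2).
  have := has_integral_weighted_linear Psi_linear a iu iv.
  rewrite (_ : a *: (fun s => B (u s)) + _ = (fun s => B ((a *: u + v) s))).
    exact: bochnerE.
  by apply/funext => s; rewrite linearP.
have dotC (u v : R -> U) : L2dot mu I ipU u v = L2dot mu I ipU v u.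
  exact: L2dotC.
(* H is regarded as a map on the pairs (z0, h) *)
pose Q : set (Z * (R -> Z)) := setT `*` Lp mu I p.
pose nuQ (x : Z * (R -> Z)) := `|x.1| + Lpnorm mu I p x.2.
have [sZ cZ] := complete_normed_rapidly Z.
have sQ : seminorm_on Q nuQ := prod_seminorm sZ (Lp_seminorm mI muI p1 Z).
have cQ : rapidly_complete Q nuQ.
  apply: prod_rapidly_complete sZ (Lp_seminorm mI muI p1 Z) cZ _ => u uP uc.
  exact: (Lp_complete mI muI p1 q0 pq uP uc).
have N_linear (a : R) x y : Q x -> Q y ->
    N (a *: x + y).1 (a *: x + y).2 = a *: N x.1 x.2 + N y.1 y.2.
  move=> [_ Qx] [_ Qy].
  by apply: (Nop_linear halpha zeta0 (normr_ge0 M) _ _ _ hxi').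
have [CN CN0 N_bounded] : exists2 C : R, 0 <= C &
    forall z0 h, Lp mu I p h -> `|N z0 h| <= C * (`|z0| + Lpnorm mu I p h).
  by apply: (Nop_bounded halpha zeta0 (normr_ge0 M) _ _ _ hxi').
have H_spec z0 h : Lp mu I p h -> kerLperp (H z0 h) /\ L (H z0 h) = N z0 h.
  move=> hp; have [u0 u02 Lu0] : (L @` Lp mu I 2%:E) (N z0 h).
    by apply: Hnull; exists (z0, h).
  have [u pu Lu] := perp_exists s2 c2 dotC dot_linear dot_sqr L_linear LB u02.
  have : [set x | kerLperp x /\ L x = N z0 h] u by split; [exact: pu|rewrite Lu].
  exact: (@xgetI _ 0).
have H_perp x : Q x -> perp (Lp mu I 2%:E) (L2dot mu I ipU) L (H x.1 x.2).
  by move=> [_ /(H_spec x.1)[]].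
have LH x : Q x -> L (H x.1 x.2) = N x.1 x.2.
  by move=> [_ /(H_spec x.1)[]].
have ae_eq_of_norm u v : Lp mu I 2%:E u -> Lp mu I 2%:E v ->
    Lpnorm mu I 2%:E (u - v) = 0 -> ae_equal mu I u v.
  move=> u2 v2 /(Lpnorm_eq0 mI muI one2 (LpB mI muI one2 u2 v2)).
  apply: filterS => s uv /uv /eqP; rewrite -[(u - v) s]/(u s - v s).
  by rewrite subr_eq0 => /eqP.
have H2 z0 h : Lp mu I p h -> Lp mu I 2%:E (H z0 h).
  by move=> /(H_spec z0)[[]].
split.
- move=> u v pu pv Luv.
  apply: ae_eq_of_norm; [by case: pu|by case: pv|].
  exact: (perp_unique s2 dot_linear dot_sqr L_linear pu pv Luv).
- exact: H_spec.
- move=> a z0 h z0' h' hp hp'.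
  apply: ae_eq_of_norm; [by apply: H2; exact: Lp_linear|by apply: Lp_linear => //; exact: H2|].
  by apply: (pseudoinverse_linear s2 dot_linear dot_sqr L_linear sQ N_linear H_perp LH
    a (x := (z0, h)) (y := (z0', h'))).
- have [C HC] := pseudoinverse_bounded s2 c2 dotC dot_linear dot_sqr L_linear LB
    sQ cQ N_linear (fun x Qx => N_bounded x.1 x.2 Qx.2) H_perp LH.
  by exists C => z0 h hp; apply: (HC (z0, h)).
- move=> z0 h hp; have [_ LHN] := H_spec z0 h hp.
  have iu := bochner_integral_correct mI muI (Lint _ (H2 z0 h hp)).
  have ih : has_bochner_integral mu I (weighted alpha Psi t2 h)
      (bochner mu I (weighted alpha Psi t2 h)).
    apply: (bochner_integral_correct mI muI).
    exact: (weighted_integrable halpha zeta0 (normr_ge0 M) Psi_linear Psi_bounded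
      Psi_continuous hxi').
  have := has_integral_weighted_linear Psi_linear (-1) iu ih.
  rewrite (_ : -1 *: (fun s => B (H z0 h s)) + h =
    (fun s => B ((- H z0 h) s) + h s)); last first.
    apply/funext => s; have -> : (- H z0 h) s = - H z0 h s by [].
    by rewrite linearN -[- B _]scaleN1r.
  move=> iuh; split; first by exists (-1 *: L (H z0 h) +
    bochner mu I (weighted alpha Psi t2 h)).
  rewrite /mild_solution (bochnerE mI muI iuh) -/(Lop _ _ _ _ _ _) -/L LHN /N /Nop.
  by rewrite scaleN1r opprD subrK subrr.
Qed.
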